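(* Let $n$ be a positive integer. There exists a bicrucial permutation of length $n$ if and only if one of the following holds: $n=9$; or $n$ is odd and $n\geq 13$; or $n$ is even, $n\geq 32$ and $n\neq 38$.
   Context: A permutation $\sigma$ of length $n$ is a permutation of $\{0,\dots,n-1\}$, written as a vector $(\sigma_0,\sigma_1,\dots,\sigma_{n-1})$ with $\sigma_i=\sigma(i)$. Two vectors $a=(a_1,\dots,a_m)$ and $b=(b_1,\dots,b_m)$ of the same length, each consisting of distinct real numbers, are order-isomorphic, written $a\sim b$, if they have the same pattern, i.e. for all $i,j$ we have $a_i<a_j$ if and only if $b_i<b_j$. A square of length $2\ell$ (where $\ell\geq 2$) in $\sigma$ is a factor (block of consecutive entries) $(S_1;S_2)=(\sigma_k,\dots,\sigma_{k+\ell-1};\sigma_{k+\ell},\dots,\sigma_{k+2\ell-1})$ with $S_1\sim S_2$. A permutation is square-free if it contains no square of length at least $4$, i.e. no square with $\ell\geq 2$ (squares with $\ell=1$ are trivial and are ignored). A right-extension of a permutation $\sigma$ of length $n$ is a permutation $\pi$ of length $n+1$ with $(\pi_0,\dots,\pi_{n-1})\sim\sigma$; equivalently, $\pi$ is formed by appending some $x\in\{0,\dots,n\}$ to the end of $\sigma$ and replacing each $\sigma_i\geq x$ by $\sigma_i+1$. A left-extension of $\sigma$ is a permutation $\pi$ of length $n+1$ with $(\pi_1,\dots,\pi_n)\sim\sigma$; equivalently, $\pi$ is formed by prepending some $x\in\{0,\dots,n\}$ and replacing each $\sigma_i\geq x$ by $\sigma_i+1$. A permutation $\sigma$ is right-crucial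 if it is square-free and every right-extension of $\sigma$ contains a square (of length at least $4$). It is left-crucial if it is square-free and every left-extension of $\sigma$ contains a square (of length at least $4$). It is bicrucial if it is both left-crucial and right-crucial. *)

(* Defs.v *)
From mathcomp Require Import all_boot all_fingroup.

Set Implicit Arguments.
Unset Strict Implicit.
Unset Printing Implicit Defensive.

Definition perm_word (n : nat) (s : {perm 'I_n}) : seq nat :=
  [seq nat_of_ord (s i) | i <- enum 'I_n].

(* Only ever applied to words with pairwise distinct letters, so comparing the
   strict orders of the entries compares the whole patterns. *)
Definition order_isomorphic (a b : seq nat) : Prop :=
  size a = size b /\
  forall i j, i < size a -> j < size a ->
    (nth 0 a i < nth 0 a j) = (nth 0 b i < nth 0 b j).

Definition factor (k l : nat) (w : seq nat) : seq nat := take l (drop k w).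

(* The bound [k + l.*2 <= size w] keeps [take]/[drop] from truncating. *)
Definition square_at (k l : nat) (w : seq nat) : Prop :=
  k + l.*2 <= size w /\
  order_isomorphic (factor k l w) (factor (k + l) l w).

(* Squares with l = 1 are trivial and do not count. *)
Definition contains_square (n : nat) (s : {perm 'I_n}) : Prop :=
  exists k l, 2 <= l /\ square_at k l (perm_word s).

Definition square_free (n : nat) (s : {perm 'I_n}) : Prop :=
  ~ contains_square s.

Definition right_extension (n : nat) (s : {perm 'I_n}) (p : {perm 'I_n.+1}) :
    Prop :=
  order_isomorphic (factor 0 n (perm_word p)) (perm_word s).

Definition left_extension (n : nat) (s : {perm 'I_n}) (p : {perm 'I_n.+1}) :
    Prop :=
  order_isomorphic (factor 1 n (perm_word p)) (perm_word s).

Definition right_crucial (n : nat) (s : {perm 'I_n}) : Prop :=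
  square_free s /\
  forall p : {perm 'I_n.+1}, right_extension s p -> contains_square p.

Definition left_crucial (n : nat) (s : {perm 'I_n}) : Prop :=
  square_free s /\
  forall p : {perm 'I_n.+1}, left_extension s p -> contains_square p.

Definition bicrucial (n : nat) (s : {perm 'I_n}) : Prop :=
  left_crucial s /\ right_crucial s.

(* Main.v *)
(* Square-freeness at half-length 2 forces the steps of a square-free word to go
   up, up, down, down, ... periodically, so every other square has a half-length
   divisible by 4.

   Nonexistence.  Suppose the last two steps of a right-crucial word go down. A
   new last letter avoiding squares of half-length 2 is above the last letter, and
   placing it just above each of the last three letters must complete a square of
   half-length 4, 8, 12, ... For even [n] this situation arises at one of the two
   ends, up to reversal and complement.  The available half-lengths are 4, 8, 12
   for [n <= 30], which already contradicts square-freeness of the last 23 letters;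
   for [n = 38] the half-length 16 is available too, and the contradiction also
   uses the other end.  These are finite case analyses on the relative order of the
   letters.

   Existence.  Let the letters at odd positions be alternately valleys, below all
   letters at even positions, and peaks, above all of them.  A square of half-length
   [4 * m] restricts to one of half-length [2 * m] among the letters at even
   positions, so choosing these by the same recipe at half the scale gives
   square-free words of any length.  Moving a few letters near the ends makes all
   extensions complete a square.  A long square touching a moved letter is
   impossible, since some moved letter is on the wrong side of a nearby peak or
   valley while its counterpart in the other half is not; the short ones lie in a
   prefix or a suffix of bounded length, of which there are finitely many
   patterns. *)

Require Import Defs.
From mathcomp Require Import all_boot all_fingroup.
From mathcomp Require Import zify.

Set Implicit Arguments.
Unset Strict Implicit.
Unset Printing Implicit Defensive.

(** * Words and their squares *)

(** Permutations become functions on [nat], of which only the first [n] values matter, so that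
    windows and reversals are index arithmetic. *)
Definition is_word (n : nat) (f : nat -> nat) : Prop :=
  (forall i, i < n -> f i < n) /\
  (forall i j, i < n -> j < n -> f i = f j -> i = j).

Definition same_order (f : nat -> nat) (k k' l : nat) : Prop :=
  forall i j, i < l -> j < l ->
    (f (k + i) < f (k + j)) = (f (k' + i) < f (k' + j)).

Definition has_square (n : nat) (f : nat -> nat) : Prop :=
  exists k l, [/\ 2 <= l, k + l.*2 <= n & same_order f k (k + l) l].

Definition right_saturated (n : nat) (f : nat -> nat) : Prop :=
  forall g, is_word n.+1 g ->
    (forall i j, i < n -> j < n -> (g i < g j) = (f i < f j)) ->
    has_square n.+1 g.

Definition flip (n : nat) (f : nat -> nat) (i : nat) : nat := f (n - i.+1).

Definition bicrucial_word (n : nat) (f : nat -> nat) : Prop :=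
  [/\ is_word n f, ~ has_square n f, right_saturated n f
    & right_saturated n (flip n f)].

Definition letter (n : nat) (s : {perm 'I_n}) (i : nat) : nat :=
  nth 0 (perm_word s) i.

Lemma size_perm_word (n : nat) (s : {perm 'I_n}) : size (perm_word s) = n.
Proof. by rewrite size_map size_enum_ord. Qed.

Lemma letter_ord (n : nat) (s : {perm 'I_n}) (i : 'I_n) : letter s i = s i.
Proof.
by rewrite /letter (nth_map i) ?size_enum_ord // nth_ord_enum.
Qed.

Lemma letter_is_word (n : nat) (s : {perm 'I_n}) : is_word n (letter s).
Proof.
split=> [i i_n|i j i_n j_n]; first by rewrite (letter_ord s (Ordinal i_n)).
rewrite (letter_ord s (Ordinal i_n)) (letter_ord s (Ordinal j_n)).
by move=> /val_inj /perm_inj [].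
Qed.

Lemma is_word_letter (n : nat) (f : nat -> nat) :
  is_word n f -> exists s : {perm 'I_n}, forall i, i < n -> letter s i = f i.
Proof.
case=> fn finj.
pose g (i : 'I_n) : 'I_n := Ordinal (fn i (ltn_ord i)).
have ginj : injective g.
  by move=> i j [] /(finj _ _ (ltn_ord i) (ltn_ord j)) /val_inj.
exists (perm ginj) => i i_n.
by rewrite (letter_ord _ (Ordinal i_n)) permE.
Qed.

Lemma nth_factor (k l i : nat) (w : seq nat) :
  i < l -> nth 0 (factor k l w) i = nth 0 w (k + i).
Proof. by move=> il; rewrite /factor nth_take // nth_drop. Qed.

Lemma size_factor (k l : nat) (w : seq nat) :
  k + l <= size w -> size (factor k l w) = l.
Proof. by move=> kl; rewrite /factor size_takel // size_drop; lia. Qed.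

Lemma contains_squareP (n : nat) (s : {perm 'I_n}) :
  contains_square s <-> has_square n (letter s).
Proof.
split=> [[k [l [l2 [kl [_ iso]]]]]|[k [l [l2 kl iso]]]].
  rewrite size_perm_word in kl; exists k, l; split=> // i j il jl.
  have := iso i j; rewrite size_factor ?size_perm_word; last by lia.
  by rewrite !nth_factor //; apply.
exists k, l; split=> //; split; first by rewrite size_perm_word.
rewrite /order_isomorphic !size_factor ?size_perm_word; try by lia.
by split=> // i j il jl; rewrite !nth_factor //; apply: iso.
Qed.

Lemma eq_has_square (n : nat) (f g : nat -> nat) :
  (forall i j, i < n -> j < n -> (f i < f j) = (g i < g j)) ->
  has_square n f -> has_square n g.
Proof.
move=> fg [k [l [l2 kl iso]]]; exists k, l; split=> // i j il jl.
by rewrite -!fg; [apply: iso | lia..].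
Qed.

Lemma has_square_flip (n : nat) (f : nat -> nat) :
  has_square n (flip n f) -> has_square n f.
Proof.
move=> [k [l [l2 kl iso]]]; exists (n - k - l.*2), l; split=> //; first by lia.
move=> i j il jl.
have := iso (l - i.+1) (l - j.+1); rewrite /flip.
have -> : n - (k + (l - i.+1)).+1 = n - k - l.*2 + l + i by lia.
have -> : n - (k + (l - j.+1)).+1 = n - k - l.*2 + l + j by lia.
have -> : n - (k + l + (l - i.+1)).+1 = n - k - l.*2 + i by lia.
have -> : n - (k + l + (l - j.+1)).+1 = n - k - l.*2 + j by lia.
by move=> ->; lia.
Qed.

Lemma flipK (n : nat) (f : nat -> nat) (i : nat) :
  i < n -> flip n (flip n f) i = f i.
Proof. by move=> i_n; rewrite /flip; congr f; lia. Qed.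

Lemma is_word_flip (n : nat) (f : nat -> nat) :
  is_word n f -> is_word n (flip n f).
Proof.
case=> fn finj; split=> [i i_n|i j i_n j_n]; first by apply: fn; lia.
by move/finj => fij; have := fij _ _; lia.
Qed.

Lemma right_saturated_eq (n : nat) (f g : nat -> nat) :
  (forall i j, i < n -> j < n -> (f i < f j) = (g i < g j)) ->
  right_saturated n f -> right_saturated n g.
Proof.
by move=> fg satf h hw hg; apply: satf => // i j i_n j_n; rewrite fg // hg.
Qed.

Lemma right_crucialP (n : nat) (s : {perm 'I_n}) :
  right_crucial s <-> ~ has_square n (letter s) /\ right_saturated n (letter s).
Proof.
have extP (p : {perm 'I_n.+1}) : right_extension s p <->
    forall i j, i < n -> j < n ->
      (letter p i < letter p j) = (letter s i < letter s j).
  rewrite /right_extension /order_isomorphic size_factor ?size_perm_word //=.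
  by split=> [[_ +]|ext]; [move=> ext|split=> //] => i j i_n j_n;
    have := ext i j i_n j_n; rewrite /letter !nth_factor.
split=> [[sf ext]|[sf sat]].
  split=> [/contains_squareP //|g gw gs].
  have [p pg] := is_word_letter gw.
  apply: (@eq_has_square _ (letter p)) => [i j i_n j_n|]; first by rewrite !pg.
  apply/contains_squareP/ext/extP => i j i_n j_n.
  by rewrite !pg ?gs //; lia.
split=> [/contains_squareP //|p /extP ps].
by apply/contains_squareP/sat => //; apply: letter_is_word.
Qed.

(** Reversal turns left extensions into right extensions and preserves squares. *)
Lemma left_crucialP (n : nat) (s : {perm 'I_n}) :
  left_crucial s <->
  ~ has_square n (letter s) /\ right_saturated n (flip n (letter s)).
Proof.
have extP (p : {perm 'I_n.+1}) : left_extension s p <->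
    forall i j, i < n -> j < n ->
      (letter p i.+1 < letter p j.+1) = (letter s i < letter s j).
  rewrite /left_extension /order_isomorphic size_factor ?size_perm_word //.
  by split=> [[_ +]|ext]; [move=> ext|split=> //] => i j i_n j_n;
    have := ext i j i_n j_n; rewrite /letter !nth_factor.
split=> [[sf ext]|[sf sat]].
  split=> [/contains_squareP //|g gw gs].
  have [p pg] := is_word_letter (is_word_flip gw).
  apply: has_square_flip.
  apply: (@eq_has_square _ (letter p)) => [i j i_n j_n|]; first by rewrite !pg.
  apply/contains_squareP/ext/extP => i j i_n j_n.
  by rewrite !pg // /flip !subSS gs /flip; first (congr (letter s _ < letter s _)); lia.
split=> [/contains_squareP //|p /extP ps].
apply/contains_squareP/has_square_flip/sat.
  exact/is_word_flip/letter_is_word.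
move=> i j i_n j_n; rewrite /flip -ps; try by lia.
by congr (letter p _ < letter p _); lia.
Qed.

Lemma bicrucialP (n : nat) :
  (exists s : {perm 'I_n}, bicrucial s) <-> exists f, bicrucial_word n f.
Proof.
split=> [[s [/left_crucialP[_ satl] /right_crucialP[sf satr]]]|].
  by exists (letter s); split=> //; apply: letter_is_word.
case=> f [fw sf satr satl]; have [s sfE] := is_word_letter fw; exists s.
have sE i j : i < n -> j < n -> (f i < f j) = (letter s i < letter s j).
  by move=> i_n j_n; rewrite !sfE.
have sf' : ~ has_square n (letter s).
  by move=> sq; apply/sf/(eq_has_square _ sq) => i j i_n j_n; rewrite sE.
split; [apply/left_crucialP | apply/right_crucialP]; split=> //.
  by apply: right_saturated_eq satl => i j i_n j_n; apply: sE; lia.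
exact: right_saturated_eq satr.
Qed.

(** * Patterns of key lists *)

Lemma alternating_odd (u : nat -> bool) (k m : nat) :
  (forall i, i < m -> u (k + i.*2.+2) = ~~ u (k + i.*2)) ->
  u (k + m.*2) = u k (+) odd m.
Proof.
elim: m => [_|m IH alt]; first by rewrite addn0 addbF.
rewrite doubleS alt // IH => [|i im]; first by rewrite /= addbN.
by apply: alt; lia.
Qed.

(* Going up or down alternates with period four, so equal up-down patterns are
   a multiple of four apart. *)
Lemma shift_dvd4 (u : nat -> bool) (k l : nat) :
  2 <= l ->
  (forall i, k <= i -> i.+3 < k + l.*2 -> u i.+2 = ~~ u i) ->
  (forall i, i.+1 < l -> u (k + i) = u (k + l + i)) -> 4 %| l.
Proof.
move=> l2 alt per.
have jump p m : k <= p -> p + m.*2.+1 < k + l.*2 ->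
    u (p + m.*2) = u p (+) odd m.
  by move=> kp pm; apply: alternating_odd => i im; rewrite !addnS alt; lia.
have l_eq : l = odd l + l./2.*2 by rewrite odd_double_half.
(* For even [l], offset 0 forces [l./2] to be even. For odd [l], offsets 0 and 1 together equate
   [u k] with its negation. *)
case l_odd: (odd l) l_eq => /= l_eq; last first.
  have := per 0 ltac:(lia); by rewrite !addn0 l_eq add0n jump; lia.
have := per 0 ltac:(lia); have := per 1 ltac:(lia).
have -> : k + l + 1 = k.+2 + l./2.*2 by lia.
have -> : k + l + 0 = k.+1 + l./2.*2 by lia.
by rewrite !jump ?alt ?addn0 ?addn1; lia.
Qed.

(** Two steps in the same direction at distance two form a square of half-length 2. So the up-down
    word of [f] alternates at distance two, and [shift_dvd4] applies to it. *)
Lemma square_dvd4 (n : nat) (f : nat -> nat) (k l : nat) :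
  (forall i j, i < n -> j < n -> f i = f j -> i = j) ->
  (forall i, k <= i -> i + 4 <= k + l.*2 -> ~ same_order f i (i + 2) 2) ->
  2 <= l -> k + l.*2 <= n -> same_order f k (k + l) l -> 4 %| l.
Proof.
move=> finj no2 l2 kl iso.
apply: (@shift_dvd4 (fun i => f i < f i.+1) k) => // [i ki il|i il]; last first.
  by have := iso i i.+1; rewrite !addnS; apply; lia.
apply/idP/idP => [u2|/negbTE u1]; last first.
  apply/negPn/negP => /negbTE u2; apply: (no2 i) => //; first by lia.
  have ne x : x.+1 < n -> f x.+1 <> f x by move=> xn /finj; lia.
  have := ne i; have := ne i.+2.
  move=> ne2 ne1 [|[|//]] [|[|//]] _ _; rewrite ?addn0 ?addn1 ?addn2 ?ltnn //.
    by rewrite u1 u2.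
  lia.
apply/negP => u1; apply: (no2 i) => //; first by lia.
move=> [|[|//]] [|[|//]] _ _; rewrite ?addn0 ?addn1 ?addn2 ?ltnn ?u1 ?u2 //.
lia.
Qed.

Fixpoint lexlt (x y : seq nat) : bool :=
  match x, y with
  | [::], [::] => false
  | [::], _ :: _ => true
  | _ :: _, [::] => false
  | a :: x', b :: y' => (a < b) || (a == b) && lexlt x' y'
  end.

Lemma lexltxx (x : seq nat) : lexlt x x = false.
Proof. by elim: x => //= a x ->; rewrite ltnn eqxx. Qed.

Lemma lexlt_trans (y x z : seq nat) : lexlt x y -> lexlt y z -> lexlt x z.
Proof.
elim: x y z => [|a x IH] [|b y] [|c z] //=.
case/orP => [ab|/andP[/eqP-> xy]]; case/orP => [bc|/andP[/eqP<- yz]].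
- by rewrite (ltn_trans ab bc).
- by rewrite ab.
- by rewrite bc.
by rewrite eqxx (IH y) // orbT.
Qed.

Lemma lexlt_total (x y : seq nat) : [|| lexlt x y, lexlt y x | x == y].
Proof.
elim: x y => [|a x IH] [|b y] //=.
by rewrite eqseq_cons; case: (ltngtP a b) => //= _; apply: IH.
Qed.

Lemma lexlt_asym (x y : seq nat) : lexlt x y -> ~~ lexlt y x.
Proof. by move=> xy; apply/negP => /(lexlt_trans xy); rewrite lexltxx. Qed.

Lemma lexlt_neq (x y : seq nat) : x != y -> lexlt y x = ~~ lexlt x y.
Proof.
move=> xy; apply/idP/idP => [/lexlt_asym //|nxy].
by case/or3P: (lexlt_total x y) nxy xy => // [->|/eqP ->]; rewrite ?eqxx.
Qed.

(* Ties are broken by position, so that any list of keys has a pattern. *)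
Definition key_lt (x y : seq nat * nat) : bool :=
  lexlt x.1 y.1 || ~~ lexlt y.1 x.1 && (x.2 < y.2).

Lemma key_ltxx (x : seq nat * nat) : key_lt x x = false.
Proof. by rewrite /key_lt lexltxx ltnn. Qed.

Lemma key_lt_trans (y x z : seq nat * nat) :
  key_lt x y -> key_lt y z -> key_lt x z.
Proof.
have incomp u v : ~~ lexlt u v -> ~~ lexlt v u -> u = v.
  by move=> /negbTE uv /negbTE vu; have := lexlt_total u v; rewrite uv vu => /eqP.
rewrite /key_lt; case/orP => [xy|/andP[nyx xy]]; case/orP => [yz|/andP[nzy yz]].
- by rewrite (lexlt_trans xy yz).
- case: (boolP (lexlt y.1 z.1)) => [yz'|nyz]; first by rewrite (lexlt_trans xy yz').
  by rewrite -(incomp _ _ nyz nzy) xy.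
- case: (boolP (lexlt x.1 y.1)) => [xy'|nxy]; first by rewrite (lexlt_trans xy' yz).
  by rewrite (incomp _ _ nxy nyx) yz.
case: (boolP (lexlt x.1 z.1)) => //= nxz.
case: (boolP (lexlt x.1 y.1)) => [xy'|nxy].
  case: (boolP (lexlt y.1 z.1)) => [yz'|nyz].
    by rewrite (lexlt_trans xy' yz') in nxz.
  by rewrite -(incomp _ _ nyz nzy) xy' in nxz.
rewrite (incomp _ _ nxy nyx) nzy; exact: ltn_trans yz.
Qed.

Lemma key_lt_total (x y : seq nat * nat) :
  x.2 != y.2 -> key_lt y x = ~~ key_lt x y.
Proof.
move=> xy; rewrite /key_lt; case: (boolP (lexlt x.1 y.1)) => [/lexlt_asym|] nxy.
  by rewrite (negbTE nxy).
by case: (lexlt y.1 x.1) => //=; lia.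
Qed.

(** Standardisation of a list of keys; pairing with positions makes the result a permutation even
    when keys repeat. *)
Definition ranks (s : seq (seq nat)) : seq nat :=
  let z := zip s (iota 0 (size s)) in
  [seq count (fun y => key_lt y x) z | x <- z].

Lemma size_ranks (s : seq (seq nat)) : size (ranks s) = size s.
Proof. by rewrite size_map size_zip size_iota minnn. Qed.

Lemma mem_zip_iota (s : seq (seq nat)) (i : nat) :
  i < size s -> (nth [::] s i, i) \in zip s (iota 0 (size s)).
Proof.
move=> i_s; have <- : nth ([::], 0) (zip s (iota 0 (size s))) i = (nth [::] s i, i).
  by rewrite nth_zip ?size_iota // nth_iota.
by rewrite mem_nth // size_zip size_iota minnn.
Qed.

Lemma nth_ranks (s : seq (seq nat)) (i : nat) : i < size s ->
  nth 0 (ranks s) i =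
    count (key_lt^~ (nth [::] s i, i)) (zip s (iota 0 (size s))).
Proof.
move=> i_s; rewrite /ranks (nth_map ([::], 0)) ?size_zip ?size_iota ?minnn //.
by rewrite nth_zip ?size_iota // nth_iota.
Qed.

Lemma sub_count_lt (T : eqType) (p q : pred T) (s : seq T) (x : T) :
  x \in s -> q x -> ~~ p x -> (forall y, p y -> q y) -> count p s < count q s.
Proof.
move=> xs qx npx pq; elim: s xs => //= y s IH; rewrite inE => /orP[/eqP <-|xs].
  by rewrite qx (negbTE npx) add0n add1n ltnS; apply: sub_count.
by have := IH xs; case py: (p y); rewrite ?(pq _ py) //=; lia.
Qed.

Lemma ranks_lt (s : seq (seq nat)) (i j : nat) : i < size s -> j < size s ->
  (nth 0 (ranks s) i < nth 0 (ranks s) j) =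
    key_lt (nth [::] s i, i) (nth [::] s j, j).
Proof.
have mono k m : k < size s -> m < size s ->
    key_lt (nth [::] s k, k) (nth [::] s m, m) ->
    nth 0 (ranks s) k < nth 0 (ranks s) m.
  move=> ks ms km; rewrite !nth_ranks //.
  apply: (sub_count_lt (mem_zip_iota ks)) => //; first by rewrite key_ltxx.
  by move=> y /key_lt_trans; apply.
move=> i_s j_s; have [->|ij] := eqVneq i j; first by rewrite ltnn key_ltxx.
apply/idP/idP => [lt_ij|]; last exact: mono.
apply/negPn/negP; rewrite -key_lt_total //= => /(mono _ _ j_s i_s); lia.
Qed.

Lemma is_word_ranks (s : seq (seq nat)) : is_word (size s) (nth 0 (ranks s)).
Proof.
split=> [i i_s|i j i_s j_s rij].
  rewrite nth_ranks //; set z := zip _ _.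
  have <- : size z = size s by rewrite size_zip size_iota minnn.
  rewrite -(count_predT z).
  by apply: (sub_count_lt (mem_zip_iota i_s)); rewrite ?key_ltxx.
apply/eqP/negPn/negP => ij.
have := ranks_lt i_s j_s; rewrite rij ltnn => /esym/negbT.
by rewrite -(@key_lt_total (_, i)) //= -ranks_lt // rij ltnn.
Qed.

(** * The layered word *)

(* Even positions carry a middle letter (key 5), odd positions alternate between
   valleys (key 3) and peaks (key 15), and the middle letters repeat this scheme
   at half the scale with valleys and peaks exchanged. *)
Fixpoint layers_rec (fuel : nat) (s : bool) (i : nat) : seq nat :=
  if fuel is fuel'.+1 then
    if odd i then [:: if odd i./2 (+) s then 15 else 3; i]
    else 5 :: layers_rec fuel' (~~ s) i./2
  else [::].

Definition layers (s : bool) (i : nat) : seq nat := layers_rec i s i.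

Lemma layers_rec_fuel (fuel : nat) (s : bool) (i : nat) :
  0 < i <= fuel -> layers_rec fuel s i = layers s i.
Proof.
rewrite /layers; elim/ltn_ind: i fuel s => -[//|i] IH [|fuel] s //= i_fuel.
case: ifP => // odd_i; congr (_ :: _).
by rewrite IH ?[RHS]IH //; lia.
Qed.

Lemma layers_odd (s : bool) (i : nat) :
  odd i -> layers s i = [:: if odd i./2 (+) s then 15 else 3; i].
Proof. by case: i => // i; rewrite /layers /= => ->. Qed.

Lemma layers_even (s : bool) (i : nat) :
  0 < i -> ~~ odd i -> layers s i = 5 :: layers (~~ s) i./2.
Proof.
case: i => // i _ /negbTE i_even; rewrite {1}/layers /= -[~~ odd i]/(odd i.+1) i_even.
by rewrite layers_rec_fuel //; lia.
Qed.

Lemma layers_inj (s : bool) (i j : nat) :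
  0 < i -> 0 < j -> layers s i = layers s j -> i = j.
Proof.
elim/ltn_ind: i s j => i IH s j i0 j0.
case: (boolP (odd i)) => i_odd; case: (boolP (odd j)) => j_odd.
- by rewrite !layers_odd // => -[].
- by rewrite layers_odd // layers_even //; case: (odd i./2 (+) s).
- by rewrite layers_even // (layers_odd s j_odd); case: (odd j./2 (+) s).
by rewrite (layers_even s i0) // (layers_even s j0) // => -[] /IH; lia.
Qed.

Definition layer_lt (s : bool) (i j : nat) : bool :=
  lexlt (layers s i) (layers s j).

Lemma layer_lt_step (s : bool) (i : nat) :
  0 < i -> layer_lt s i i.+1 = odd i (+) odd i./2 (+) s.
Proof.
move=> i0; rewrite /layer_lt; case: (boolP (odd i)) => i_odd.
  rewrite (layers_odd s i_odd) (@layers_even s i.+1) /= ?i_odd //.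
  by case: (odd i./2); case: s.
rewrite (layers_even s i0 i_odd) (@layers_odd s i.+1) //= uphalf_half.
by rewrite (negbTE i_odd) add0n; case: (odd i./2); case: s.
Qed.

Lemma layer_lt_even (s : bool) (i j : nat) : 0 < i -> 0 < j ->
  layer_lt s i.*2 j.*2 = layer_lt (~~ s) i j.
Proof.
move=> i0 j0; rewrite /layer_lt (@layers_even s i.*2) ?(@layers_even s j.*2);
  by rewrite ?odd_double ?double_gt0 //= !doubleK.
Qed.

Lemma layer_lt_mid (i j : nat) : 0 < i -> ~~ odd i -> odd j ->
  layer_lt false i j = odd j./2.
Proof.
by move=> i0 i_even j_odd; rewrite /layer_lt layers_even // (layers_odd _ j_odd) /=; case: odd.
Qed.

Lemma layers_square_free (s : bool) (k l : nat) : 0 < k -> 2 <= l ->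
  ~ (forall i j, i < l -> j < l ->
       layer_lt s (k + i) (k + j) = layer_lt s (k + l + i) (k + l + j)).
Proof.
elim/ltn_ind: l s k => l IH s k k0 l2 iso.
have /dvdnP[m l_eq] : 4 %| l.
  apply: (@shift_dvd4 (fun i => layer_lt s i i.+1) k) => // [i ki _|i il].
    rewrite !layer_lt_step //; last by lia.
    by rewrite /= negbK; case: (odd i); case: (odd i./2); case: (s).
  by have := iso i i.+1; rewrite !addnS; apply; lia.
(* The first even position of the window is [k + odd k], twice [uphalf k]. *)
apply: (IH m.*2 _ (~~ s) (uphalf k)); [lia..|] => i j im jm.
rewrite -!layer_lt_even; try lia.
have := iso (odd k + i.*2) (odd k + j.*2) ltac:(lia) ltac:(lia).
have -> x : k + (odd k + x.*2) = (uphalf k + x).*2 by lia.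
have -> : k + (odd k + j.*2) = (uphalf k + j).*2 by lia.
have -> : k + l + (odd k + i.*2) = (uphalf k + m.*2 + i).*2 by lia.
by have -> : k + l + (odd k + j.*2) = (uphalf k + m.*2 + j).*2 by lia.
Qed.

Lemma half_shift (r d x : nat) : (x + d * 2 ^ r.+1)./2 = x./2 + d * 2 ^ r.
Proof. by rewrite expnS; lia. Qed.

Lemma odd_shift (r d x : nat) : 0 < r -> odd (x + d * 2 ^ r) = odd x.
Proof. by case: r => // r _; rewrite oddD oddM oddX /= andbF addbF. Qed.

Lemma layers_odd_shift (r d : nat) (s : bool) (x : nat) : 0 < r -> odd x ->
  layers s (x + d * 2 ^ r.+1) =
    [:: if odd x./2 (+) s then 15 else 3; x + d * 2 ^ r.+1].
Proof.
by move=> r0 x_odd; rewrite layers_odd ?odd_shift // half_shift odd_shift.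
Qed.

Lemma layers_even_shift (r d : nat) (s : bool) (x : nat) :
  0 < x -> ~~ odd x ->
  layers s (x + d * 2 ^ r.+1) = 5 :: layers (~~ s) (x./2 + d * 2 ^ r).
Proof.
by move=> x0 x_even; rewrite layers_even ?odd_shift ?addn_gt0 ?x0 // half_shift.
Qed.

(** Halving the positions halves the shift and the allowed distance alike. A shift by a multiple of
    4 preserves valleys and peaks; at [r = 1] two even positions closer than 2 coincide. *)
Lemma layers_shift (r d : nat) (s : bool) (i j : nat) :
  0 < r -> 0 < i -> 0 < j -> i < j + 2 ^ r -> j < i + 2 ^ r ->
  layer_lt s (i + d * 2 ^ r.+1) (j + d * 2 ^ r.+1) = layer_lt s i j.
Proof.
elim: r s i j => // r IH s i j _ i0 j0 ij ji.
rewrite /layer_lt; case: (boolP (odd i)) => i_odd; case: (boolP (odd j)) => j_odd.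
- rewrite !layers_odd_shift // !layers_odd //= !andbF !orbF ltn_add2r.
  by do 2 case: (_ (+) s).
- rewrite layers_odd_shift // layers_even_shift // (layers_odd s i_odd).
  by rewrite (layers_even s j0) //=; case: (_ (+) s).
- rewrite layers_even_shift // (@layers_odd_shift _ _ _ j) // (layers_odd s j_odd).
  by rewrite (layers_even s i0) //=; case: (_ (+) s).
rewrite (layers_even_shift _ _ _ i0) // (layers_even_shift _ _ _ j0) //.
rewrite (layers_even s i0) // (layers_even s j0) //=.
case: r IH ij ji => [|r] IH ij ji.
  by rewrite (_ : i = j) ?lexltxx //; lia.
by apply: IH => //; rewrite expnS in ij ji; lia.
Qed.

(** * Computable tests for patterns, squares and saturation *)

Fixpoint same_pattern (x y : seq nat) : bool :=
  match x, y with
  | [::], [::] => true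
  | a :: x', b :: y' =>
      all2 (fun c d => ((a < c) == (b < d)) && ((c < a) == (d < b))) x' y' &&
      same_pattern x' y'
  | _, _ => false
  end.

Lemma same_patternP (x y : seq nat) : size x = size y ->
  reflect (forall i j, i < size x -> j < size x ->
             (nth 0 x i < nth 0 x j) = (nth 0 y i < nth 0 y j))
          (same_pattern x y).
Proof.
elim: x y => [[|b y] // _|a x IH [|b y] //= [sz]]; first exact: ReflectT.
have all2E : reflect (forall i, i < size x ->
      (a < nth 0 x i) = (b < nth 0 y i) /\ (nth 0 x i < a) = (nth 0 y i < b))
    (all2 (fun c d => ((a < c) == (b < d)) && ((c < a) == (d < b))) x y).
  rewrite all2E sz eqxx /=; apply: (iffP (all_nthP (0, 0))) => h i.
    rewrite -sz => i_x; have := h i; rewrite size_zip sz minnn -sz nth_zip //=.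
    by move=> /(_ i_x) /andP[/eqP -> /eqP ->].
  rewrite size_zip sz minnn nth_zip //= => i_y.
  by case: (h i) => [|-> ->]; rewrite ?sz // !eqxx.
apply: (iffP andP) => [[/all2E h1 /(IH _ sz) h2] [|i] [|j]|h] //=.
- by rewrite !ltnn.
- by move=> _ /h1[].
- by move=> /h1[].
- by move=> i_x j_x; apply: h2.
split; first by apply/all2E => i i_x; rewrite (h 0 i.+1) // (h i.+1 0).
by apply/(IH _ sz) => i j i_x j_x; apply: (h i.+1 j.+1).
Qed.

Definition no_square (u : seq nat) : bool :=
  all (fun l => all (fun k =>
      ~~ same_pattern (factor k l u) (factor (k + l) l u))
    (iota 0 (size u - l.*2).+1)) (iota 2 (size u)./2.-1).

Lemma no_squareP (u : seq nat) (f : nat -> nat) (p k l : nat) :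
  no_square u ->
  (forall i j, i < size u -> j < size u ->
    (f (p + i) < f (p + j)) = (nth 0 u i < nth 0 u j)) ->
  2 <= l -> p <= k -> k + l.*2 <= p + size u -> ~ same_order f k (k + l) l.
Proof.
move=> nosq fu l2 pk kl iso.
have l_mem : l \in iota 2 (size u)./2.-1 by rewrite mem_iota; lia.
have := allP nosq l l_mem => /allP /(_ (k - p)).
rewrite mem_iota => /(_ ltac:(lia)) /negP; apply.
apply/same_patternP; rewrite !size_factor; try lia.
move=> i j il jl; rewrite !nth_factor // -!fu; try lia.
have e x : p + (k - p + x) = k + x by lia.
have e' x : p + (k - p + l + x) = k + l + x by lia.
by rewrite !e !e'; apply: iso.
Qed.

Definition append (c : nat) (u : seq nat) : seq nat :=
  rcons [seq x + (c <= x) | x <- u] c.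

(** A sufficient test: it seeks only squares that end in the new letter and have one of four
    half-lengths, which is enough for all words built here. *)
Definition saturated (u : seq nat) : bool :=
  all (fun c => let v := append c u in
    has (fun l => (l.*2 <= size v) &&
      same_pattern (factor (size v - l.*2) l v) (factor (size v - l) l v))
    [:: 2; 4; 8; 16]) (iota 0 (size u).+1).

(** Saturation is local: relative to the suffix [u] a new letter takes one of [size u + 1] values,
    and each completes a square within that suffix. *)
Lemma saturatedP (n : nat) (f : nat -> nat) (u : seq nat) :
  size u <= n -> all (ltn^~ (size u)) u ->
  (forall i j, i < size u -> j < size u ->
    (f (n - size u + i) < f (n - size u + j)) = (nth 0 u i < nth 0 u j)) ->
  saturated u -> right_saturated n f.
Proof.
move=> un /allP u_lt fu sat g [gn ginj] gf; set Q := size u in un u_lt fu.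
(* The new letter's value relative to [u]: just above the largest letter below it, or 0 if there is
   none. *)
pose c := \max_(i < Q | g (n - Q + i) < g n) (nth 0 u i).+1.
have gu i j : i < Q -> j < Q ->
    (g (n - Q + i) < g (n - Q + j)) = (nth 0 u i < nth 0 u j).
  by move=> iQ jQ; rewrite gf ?fu //; lia.
have gc i : i < Q -> (g (n - Q + i) < g n) = (nth 0 u i < c).
  move=> iQ; apply/idP/idP => [gi|].
    exact: (@leq_bigmax_cond _ _ (fun i : 'I_Q => (nth 0 u i).+1) (Ordinal iQ)).
  apply: contraLR; rewrite -!leqNgt => gi; apply/bigmax_leqP => j gj.
  by rewrite -gu //; apply: leq_trans gi.
have c_max : c <= Q by apply/bigmax_leqP => j _; apply/u_lt/mem_nth.
have /hasP[l l_mem /andP[l_size pat]] := allP sat c ltac:(by rewrite mem_iota).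
have v_size : size (append c u) = Q.+1 by rewrite size_rcons size_map.
rewrite v_size in l_size pat.
have gv i j : i <= Q -> j <= Q -> (g (n - Q + i) < g (n - Q + j)) =
    (nth 0 (append c u) i < nth 0 (append c u) j).
  have gn_eq : n - Q + Q = n by lia.
  have v_nth x : x < Q -> nth 0 (append c u) x = nth 0 u x + (c <= nth 0 u x).
    by move=> xQ; rewrite nth_rcons size_map xQ (nth_map 0).
  have v_last : nth 0 (append c u) Q = c by rewrite nth_rcons size_map ltnn eqxx.
  rewrite [i <= Q]leq_eqVlt [j <= Q]leq_eqVlt.
  case/orP => [/eqP ->|iQ]; case/orP => [/eqP ->|jQ]; rewrite ?ltnn //.
  - have ne : g (n - Q + j) <> g n by move/ginj; lia.
    by rewrite v_last v_nth // gn_eq; have := gc j jQ; lia.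
  - by rewrite v_last v_nth // gn_eq gc //; lia.
  by rewrite !v_nth // gu //; lia.
exists (n.+1 - l.*2), l; split; [|by lia|].
  by case: l {l_size pat} l_mem => [|[|]].
have {}pat := elimT (same_patternP _) pat.
rewrite !size_factor ?v_size in pat; try lia.
move=> i j il jl; have := pat erefl i j il jl; rewrite !nth_factor // -!gv; try lia.
have -> x : n - Q + (Q.+1 - l.*2 + x) = n.+1 - l.*2 + x by lia.
have -> : n - Q + (Q.+1 - l.*2 + j) = n.+1 - l.*2 + j by lia.
have -> : n - Q + (Q.+1 - l + i) = n.+1 - l.*2 + l + i by lia.
by have -> : n - Q + (Q.+1 - l + j) = n.+1 - l.*2 + l + j by lia.
Qed.

(** * Moving letters near the ends *)

Fixpoint lookup (x : nat) (t : seq (nat * (nat * nat))) : option (nat * nat) :=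
  if t is (y, v) :: t' then if x == y then Some v else lookup x t' else None.

(* In a word whose position [i] has absolute position [a + i], an entry
   [(i, (c, d))] moves the letter in position [i]: its key becomes [[:: c; a + d]],
   so with [c = 15] it is placed among the peaks as if it were one standing at
   [a + d], with [c = 6] or [7] between the middle letters and the peaks, with
   [c = 4] between the valleys and the middle letters, with [c > 15] above the peaks
   and with [c < 3] below the valleys.  The tables depend on the phase of the start
   and were found by experiment. *)
Definition start_slots (a : nat) : seq (nat * (nat * nat)) :=
  match a %% 16 with
  | 0 | 8 => [:: (0, (30, 0))]
  | 2 | 10 => [:: (0, (0, 0))]
  | 4 | 12 => [:: (0, (30, 0)); (3, (16, 3)); (6, (15, 13)); (7, (15, 14));
                  (8, (15, 12))]
  | 6 => [:: (0, (2, 0)); (6, (4, 6)); (7, (1, 7)); (8, (2, 8))]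
  | 14 => [:: (0, (2, 0)); (2, (4, 2)); (7, (1, 7)); (8, (2, 8))]
  | _ => [::]
  end.

(* Positions are counted from the last letter, and values are those of absolute
   position [a + n + 2 - d]; the key 5 is that of the unmoved letter standing at that
   position. *)
Definition end_slots (n : nat) : seq (nat * (nat * nat)) :=
  if odd n then [:: (0, (0, 3))]
  else [:: (0, (15, 14)); (1, (15, 8)); (5, (6, 8)); (7, (15, 15));
           (8, (6, 11)); (9, (15, 16)); (15, (15, 20)); (16, (15, 30));
           (17, (15, 24)); (21, (7, 24)); (23, (15, 31)); (24, (5, 0));
           (25, (15, 32))].

Definition slot (a n i : nat) : nat * nat :=
  if lookup i (start_slots a) is Some (c, d) then (c, a + d)
  else if lookup (n - i.+1) (end_slots n) is Some (c, d) then (c, a + n + 2 - d)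
  else (5, a + i).

Definition slot_key (v : nat * nat) : seq nat :=
  if v.1 == 5 then layers false v.2 else [:: v.1; v.2].

(* The word ends just before an absolute position that is 1 or 10 modulo 128, so that
   the suffixes of all long words of the same parity look alike. *)
Definition start (n : nat) : nat :=
  128 * (n %/ 128).+1 + (if odd n then 1 else 10) - n.

Definition keys (a n p q : nat) : seq (seq nat) :=
  [seq slot_key (slot a n i) | i <- iota p q].

Lemma lookup_mem (x : nat) (t : seq (nat * (nat * nat))) (v : nat * nat) :
  lookup x t = Some v -> (x, v) \in t.
Proof.
elim: t => //= -[y w] t IH; case: eqP => [-> [->]|_ /IH]; rewrite inE ?eqxx //.
by move=> ->; rewrite orbT.
Qed.

Lemma lookup_none (h x : nat) (t : seq (nat * (nat * nat))) :
  all (fun p => p.1 < h) t -> h <= x -> lookup x t = None.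
Proof.
move=> /allP t_h hx; case E: (lookup x t) => [v|] //.
by have /= := t_h _ (lookup_mem E); lia.
Qed.

(** The start table depends only on [a] modulo 16, so its properties reduce to 16 computations. *)
Lemma start_slots_mod (P : nat -> seq (nat * (nat * nat)) -> bool) (a : nat) :
  all (fun r => P r (start_slots r)) (iota 0 16) -> P (a %% 16) (start_slots a).
Proof.
have -> : start_slots a = start_slots (a %% 16) by rewrite /start_slots modn_mod.
by move=> /allP/(_ (a %% 16)); apply; rewrite mem_iota ltn_pmod.
Qed.

Lemma start_lookup (a i : nat) :
  (if a %% 8 <= 2 then 1 else 9) <= i -> lookup i (start_slots a) = None.
Proof.
apply: lookup_none; rewrite -(@modn_dvdm 16 a 8) //.
exact: (@start_slots_mod (fun r => all (fun p => p.1 < if r %% 8 <= 2 then 1 else 9)) a isT).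
Qed.

Arguments lookup : simpl never.

Lemma end_lookup (n e : nat) :
  (if odd n then 1 else 26) <= e -> lookup e (end_slots n) = None.
Proof. by apply: lookup_none; rewrite /end_slots; case: odd. Qed.

(** Compares two letters from their slots alone, which allows windows of words of different lengths
    to be matched. *)
Definition entry_lt (a n i j : nat) : bool :=
  key_lt (slot_key (slot a n i), i) (slot_key (slot a n j), j).

Lemma keys_ranks_lt (a n p q i j : nat) : i < q -> j < q ->
  (nth 0 (ranks (keys a n p q)) i < nth 0 (ranks (keys a n p q)) j) =
    entry_lt a n (p + i) (p + j).
Proof.
move=> iq jq; rewrite ranks_lt ?size_map ?size_iota // /entry_lt /key_lt /=.
by rewrite !(nth_map 0) ?size_iota // !nth_iota // ltn_add2l.
Qed.

Lemma slot_key_shift (r d c c' x x' : nat) :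
  0 < r -> 0 < x -> 0 < x' -> x < x' + 2 ^ r -> x' < x + 2 ^ r ->
  lexlt (slot_key (c, x + d * 2 ^ r.+1)) (slot_key (c', x' + d * 2 ^ r.+1)) =
  lexlt (slot_key (c, x)) (slot_key (c', x')).
Proof.
move=> r0 x0 x'0 xx' x'x; rewrite /slot_key /=; set D := d * _.
case: (eqVneq c 5) => [_|c5]; case: (eqVneq c' 5) => [_|c'5].
- exact: layers_shift.
- case: (boolP (odd x)) => x_odd.
    by rewrite layers_odd_shift // layers_odd //= !andbF !orbF ltn_add2r.
  rewrite layers_even_shift // (layers_even _ x0) //=.
  by case: ltngtP c'5.
- case: (boolP (odd x')) => x_odd.
    by rewrite layers_odd_shift // layers_odd //= !andbF !orbF ltn_add2r.
  rewrite layers_even_shift // (layers_even _ x'0) //=.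
  by case: ltngtP c5.
by rewrite /= !andbF !orbF ltn_add2r.
Qed.

Lemma entry_lt_shift (r d a n a' n' p p' i j : nat) :
  0 < r ->
  (forall k, k \in [:: i; j] ->
     [/\ 0 < (slot a n (p + k)).2, (slot a' n' (p' + k)).1 = (slot a n (p + k)).1
       & (slot a' n' (p' + k)).2 = (slot a n (p + k)).2 + d * 2 ^ r.+1]) ->
  (slot a n (p + i)).2 < (slot a n (p + j)).2 + 2 ^ r ->
  (slot a n (p + j)).2 < (slot a n (p + i)).2 + 2 ^ r ->
  entry_lt a' n' (p' + i) (p' + j) = entry_lt a n (p + i) (p + j).
Proof.
move=> r0 sh ij ji; rewrite /entry_lt /key_lt /= !ltn_add2l.
have [i0 i1 i2] := sh i ltac:(by rewrite inE eqxx).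
have [j0 j1 j2] := sh j ltac:(by rewrite !inE eqxx orbT).
move: i0 i1 i2 j0 j1 j2 ij ji {sh}.
case: (slot a' _ (_ + i)) (slot a' _ (_ + j)) => [c1 x1] [c2 x2] /=.
case: (slot a _ (_ + i)) (slot a _ (_ + j)) => [c x] [c' x'] /=.
by move=> x0 -> -> x'0 -> -> xx' x'x; rewrite !slot_key_shift.
Qed.

Lemma slot_mid (a n i : nat) :
  (if a %% 8 <= 2 then 1 else 9) <= i ->
  i + (if odd n then 1 else 26) < n -> slot a n i = (5, a + i).
Proof.
by move=> ai ni; rewrite /slot start_lookup // end_lookup //; case: odd ni; lia.
Qed.

Lemma entry_lt_mid (a n i j : nat) : 0 < a ->
  slot a n i = (5, a + i) -> slot a n j = (5, a + j) ->
  entry_lt a n i j = layer_lt false (a + i) (a + j).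
Proof.
move=> a0 si sj; rewrite /entry_lt si sj /key_lt /slot_key /= /layer_lt.
have [->|ij] := eqVneq i j; first by rewrite lexltxx ltnn.
rewrite -lexlt_neq ?orb_andr ?orbb; last first.
  by apply/eqP => /layers_inj; lia.
by case: lexlt.
Qed.

Lemma start_gt0 (n : nat) : 0 < start n.
Proof. by rewrite /start; have := ltn_ceil n (isT : 0 < 128); case: odd; lia. Qed.

Lemma start_end (n : nat) :
  start n + n = (if odd n then 129 else 138) + (n %/ 128) * 2 ^ 7.
Proof.
have := start_gt0 n; rewrite /start (_ : 2 ^ 7 = 128) //; case: odd; lia.
Qed.

Lemma start_even (n : nat) : ~~ odd (start n).
Proof.
have := congr1 odd (start_end n).
by rewrite !oddD oddM oddX /= andbF addbF; case: odd => //=; case: (odd n).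
Qed.

Lemma prefix_slot (a n k : nat) : 56 <= n -> k < 30 ->
  let v := odflt (5, k) (lookup k (start_slots a)) in
  slot a n k = (v.1, a + v.2) /\ v.2 < 30.
Proof.
move=> n56 k30 /=; rewrite /slot; case E: (lookup k _) => [[c d]|] /=.
  have /allP/(_ _ (lookup_mem E)) /= : all (fun p => p.2.2 <= 14) (start_slots a).
    exact: (@start_slots_mod (fun _ => all (fun p => p.2.2 <= 14)) a isT).
  by split=> //; lia.
(* Here 56 is 30 + 26: the prefix window stays clear of the end table. *)
by rewrite end_lookup //; case: odd; lia.
Qed.

(** The slots of the first 30 letters refer to positions less than [2 ^ 5] apart, so a shift by a
    multiple of 64 keeps their order. Only the start modulo 64 then matters. *)
Lemma prefix_shift (a d n n' i j : nat) :
  0 < a -> 56 <= n -> 56 <= n' -> i < 30 -> j < 30 ->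
  entry_lt (a + d * 2 ^ 6) n' i j = entry_lt a n i j.
Proof.
move=> a0 n56 n'56 i30 j30.
have tabE : start_slots (a + d * 2 ^ 6) = start_slots a.
  rewrite /start_slots (_ : d * 2 ^ 6 = d * 4 * 16); last by lia.
  by rewrite [a + _]addnC modnMDl.
have [ei li] := prefix_slot a n56 i30; have [ej lj] := prefix_slot a n56 j30.
rewrite -[i]add0n -[j]add0n.
apply: (@entry_lt_shift 5 d a n _ n' 0 0) => //; rewrite ?add0n ?ei ?ej /=; try lia.
move=> k; rewrite !inE add0n => k_ij; have k30 : k < 30 by case/orP: k_ij => /eqP ->.
have [-> _] := prefix_slot a n56 k30.
have [-> _] := prefix_slot (a + d * 2 ^ 6) n'56 k30.
by rewrite tabE /=; split=> //; lia.
Qed.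

Lemma prefix_lt (n i j : nat) : 56 <= n -> i < 30 -> j < 30 ->
  entry_lt (start n) n i j = entry_lt (64 + start n %% 64) 80 i j.
Proof.
move=> n56 i30 j30; have a0 := start_gt0 n.
rewrite -(@prefix_shift (start n) 1 n 80) // mul1n.
rewrite {1}(divn_eq (start n) 64) -addnA addnC [start n %% 64 + _]addnC.
by rewrite (@prefix_shift _ _ 80).
Qed.

(** The reference word, with start 38 and length 100, ends at 138, which is 10 modulo 128. Its last
    57 slots refer to positions less than 64 apart, so shifts by multiples of 128 keep their
    order. *)
Lemma suffix_lt (n i j : nat) : 80 <= n -> ~~ odd n -> i < 57 -> j < 57 ->
  entry_lt (start n) n (n - 57 + i) (n - 57 + j) = entry_lt 38 100 (43 + i) (43 + j).
Proof.
move=> n80 n_even i57 j57; have a_end := start_end n; rewrite (negbTE n_even) in a_end.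
have slotE k : k < 57 ->
    let v := odflt (5, 59 - k) (lookup (56 - k) (end_slots 100)) in
    [/\ slot (start n) n (n - 57 + k) = (v.1, start n + n + 2 - v.2),
        slot 38 100 (43 + k) = (v.1, 140 - v.2) & v.2 < 60].
  move=> k57 /=; rewrite /slot !start_lookup; try by [case: (_ <= 2); lia].
  rewrite (_ : n - (n - 57 + k).+1 = 56 - k); last by lia.
  rewrite (_ : 100 - (43 + k).+1 = 56 - k); last by lia.
  rewrite (_ : end_slots n = end_slots 100); last by rewrite /end_slots (negbTE n_even).
  case E: (lookup _ _) => [[c d]|] /=.
    have /allP/(_ _ (lookup_mem E)) /= : all (fun p => p.2.2 <= 32) (end_slots 100) by [].
    by move=> d_le; split=> //; try congr (_, _); lia.
  by split=> //; try congr (_, _); lia.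
have [ei ei' li] := slotE i i57; have [ej ej' lj] := slotE j j57.
apply: (@entry_lt_shift 6 (n %/ 128)) => //; rewrite ?ei' ?ej' /=; try lia.
move=> k; rewrite !inE => k_ij; have k57 : k < 57 by case/orP: k_ij => /eqP ->.
have [-> -> vk] := slotE k k57; rewrite /= a_end; split=> //; lia.
Qed.

(** The reference word now ends at 28 + 101 = 129. Seven letters and a new one hold squares of
    half-length 2 and 4. *)
Lemma odd_suffix_lt (n i j : nat) : 80 <= n -> odd n -> i < 7 -> j < 7 ->
  entry_lt (start n) n (n - 7 + i) (n - 7 + j) = entry_lt 28 101 (94 + i) (94 + j).
Proof.
move=> n80 n_odd i7 j7; have a_end := start_end n; rewrite n_odd in a_end.
have slotE k : k < 7 ->
    let v := odflt (5, 9 - k) (lookup (6 - k) (end_slots 101)) in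
    [/\ slot (start n) n (n - 7 + k) = (v.1, start n + n + 2 - v.2),
        slot 28 101 (94 + k) = (v.1, 131 - v.2) & v.2 < 10].
  move=> k7 /=; rewrite /slot !start_lookup; try by [case: (_ <= 2); lia].
  rewrite (_ : n - (n - 7 + k).+1 = 6 - k); last by lia.
  rewrite (_ : 101 - (94 + k).+1 = 6 - k); last by lia.
  rewrite (_ : end_slots n = end_slots 101); last by rewrite /end_slots n_odd.
  case E: (lookup _ _) => [[c d]|] /=.
    have /allP/(_ _ (lookup_mem E)) /= : all (fun p => p.2.2 <= 3) (end_slots 101) by [].
    by move=> d_le; split=> //; try congr (_, _); lia.
  by split=> //; try congr (_, _); lia.
have [ei ei' li] := slotE i i7; have [ej ej' lj] := slotE j j7.
apply: (@entry_lt_shift 6 (n %/ 128)) => //; rewrite ?ei' ?ej' /=; try lia.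
move=> k; rewrite !inE => k_ij; have k7 : k < 7 by case/orP: k_ij => /eqP ->.
have [-> -> vk] := slotE k k7; rewrite /= a_end; split=> //; lia.
Qed.

(* The last conjunct says that positions [x] and [x + 3] are ordered in the way
   opposite to unmoved letters; likewise for the pairs [51 - e], [56 - e] and
   [3], [6] below. *)
Definition prefix_check (r : nat) (u : seq nat) : bool :=
  let x := if r %% 8 <= 2 then 0 else 8 in
  [&& no_square u, saturated (rev u)
    & (nth 0 u x < nth 0 u (x + 3)) != odd (r + (x + 3))./2].

Definition suffix_check (u : seq nat) : bool :=
  [&& no_square u, saturated u
    & all (fun e => nth 0 u (51 - e) < nth 0 u (56 - e)) [:: 25; 17; 9]].

Definition odd_suffix_check (u : seq nat) : bool :=
  [&& no_square u, saturated u & nth 0 u 6 < nth 0 u 3].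

Lemma prefix_checked (r : nat) : r < 64 -> ~~ odd r ->
  prefix_check r (ranks (keys (64 + r) 80 0 30)).
Proof.
move=> r64 r_even.
have : all (fun r => prefix_check r (ranks (keys (64 + r) 80 0 30)))
           [seq i.*2 | i <- iota 0 32] by vm_compute.
move=> /allP; apply; apply/mapP; exists r./2; last by lia.
by rewrite mem_iota; lia.
Qed.

Lemma suffix_checked : suffix_check (ranks (keys 38 100 43 57)).
Proof. by vm_compute. Qed.

Lemma odd_suffix_checked : odd_suffix_check (ranks (keys 28 101 94 7)).
Proof. by vm_compute. Qed.

Definition long_word (n : nat) : nat -> nat :=
  nth 0 (ranks (keys (start n) n 0 n)).

Lemma size_keys (a n p q : nat) : size (keys a n p q) = q.
Proof. by rewrite size_map size_iota. Qed.

Lemma long_word_lt (n i j : nat) : i < n -> j < n ->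
  (long_word n i < long_word n j) = entry_lt (start n) n i j.
Proof. by move=> i_n j_n; rewrite keys_ranks_lt. Qed.

Lemma long_is_word (n : nat) : is_word n (long_word n).
Proof. by have := is_word_ranks (keys (start n) n 0 n); rewrite size_keys. Qed.

Lemma keys_ranks_bound (a n p q : nat) :
  all (ltn^~ q) (ranks (keys a n p q)).
Proof.
have [bound _] := is_word_ranks (keys a n p q); rewrite size_keys in bound.
apply/(all_nthP 0) => i; rewrite size_ranks size_keys; exact: bound.
Qed.

Lemma prefix_pattern (n : nat) : 80 <= n -> exists u,
  [/\ size u = 30, all (ltn^~ 30) u, prefix_check (start n %% 64) u
    & forall i j, i < 30 -> j < 30 ->
        (long_word n i < long_word n j) = (nth 0 u i < nth 0 u j)].
Proof.
move=> n80; exists (ranks (keys (64 + start n %% 64) 80 0 30)); split.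
- by rewrite size_ranks size_keys.
- exact: keys_ranks_bound.
- apply: prefix_checked; first by rewrite ltn_pmod.
  by have := start_even n; lia.
move=> i j i30 j30; rewrite long_word_lt; try lia.
by rewrite keys_ranks_lt // prefix_lt //; lia.
Qed.

Lemma suffix_pattern (n : nat) : 80 <= n -> ~~ odd n -> exists u,
  [/\ size u = 57, all (ltn^~ 57) u, suffix_check u
    & forall i j, i < 57 -> j < 57 ->
        (long_word n (n - 57 + i) < long_word n (n - 57 + j)) =
        (nth 0 u i < nth 0 u j)].
Proof.
move=> n80 n_even; exists (ranks (keys 38 100 43 57)); split.
- by rewrite size_ranks size_keys.
- exact: keys_ranks_bound.
- exact: suffix_checked.
move=> i j i57 j57; rewrite long_word_lt; try lia.
by rewrite keys_ranks_lt // suffix_lt.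
Qed.

Lemma odd_suffix_pattern (n : nat) : 80 <= n -> odd n -> exists u,
  [/\ size u = 7, all (ltn^~ 7) u, odd_suffix_check u
    & forall i j, i < 7 -> j < 7 ->
        (long_word n (n - 7 + i) < long_word n (n - 7 + j)) =
        (nth 0 u i < nth 0 u j)].
Proof.
move=> n80 n_odd; exists (ranks (keys 28 101 94 7)); split.
- by rewrite size_ranks size_keys.
- exact: keys_ranks_bound.
- exact: odd_suffix_checked.
move=> i j i7 j7; rewrite long_word_lt; try lia.
by rewrite keys_ranks_lt // odd_suffix_lt.
Qed.

(** A square inside the prefix window, the suffix window or the unmoved middle is already excluded.
    Any other one pairs a misplaced letter and a neighbour with two unmoved letters [l] positions
    away. Since 4 divides [l], these have the same types, but they are in layered order. *)
Lemma long_square_free (n : nat) : 80 <= n -> ~ has_square n (long_word n).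
Proof.
move=> n80 [k [l [l2 kl iso]]]; set f := long_word n in iso.
have a0 := start_gt0 n; have a_even := start_even n; have a_end := start_end n.
have [pu [pu_size _ /and3P[pu_nosq _] +] pu_lt] := prefix_pattern n80.
rewrite (@modn_dvdm 64 _ 8) //.
set a := start n in a0 a_even a_end *.
(* Start moves stay below position [h], end moves within the last [g] positions. *)
pose h := if a %% 8 <= 2 then 1 else 9; pose g := if odd n then 1 else 26.
have h9 : 1 <= h <= 9 by rewrite /h; case: ifP.
have g26 : 1 <= g <= 26 by rewrite /g; case: ifP.
have mid_lt i j : h <= i -> i + g < n -> h <= j -> j + g < n ->
    (f i < f j) = layer_lt false (a + i) (a + j).
  move=> hi ign hj jgn; rewrite long_word_lt; try lia.
  by rewrite entry_lt_mid // slot_mid.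
have mid_free k' l' : 2 <= l' -> h <= k' -> k' + l'.*2 + g <= n ->
    ~ same_order f k' (k' + l') l'.
  move=> l'2 hk' kg iso'; apply: (@layers_square_free false (a + k') l') => //.
    by lia.
  move=> i j il jl; have := iso' i j il jl.
  by rewrite !mid_lt ?addnA //; lia.
have pre_free k' l' : 2 <= l' -> k' + l'.*2 <= 30 ->
    ~ same_order f k' (k' + l') l'.
  move=> l'2 kl'; have := @no_squareP pu f 0 k' l' pu_nosq; rewrite pu_size; exact.
have suf_free k' l' : 2 <= l' -> n - (if odd n then 7 else 57) <= k' ->
    k' + l'.*2 <= n -> ~ same_order f k' (k' + l') l'.
  case: (boolP (odd n)) => n_odd l'2 nk kl'.
    have [u [u_size _ /and3P[nosq _ _] u_lt]] := odd_suffix_pattern n80 n_odd.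
    by apply: (@no_squareP u f (n - 7) k' l' nosq); rewrite ?u_size //; lia.
  have [u [u_size _ /and3P[nosq _ _] u_lt]] := suffix_pattern n80 n_odd.
  by apply: (@no_squareP u f (n - 57) k' l' nosq); rewrite ?u_size //; lia.
(* The three regions overlap enough for any four consecutive letters to lie in one of them. *)
have no2 i : i + 4 <= n -> ~ same_order f i (i + 2) 2.
  move=> i4; case: (leqP (i + 4) 30) => [/(@pre_free i 2)|i30]; first exact.
  case: (leqP (i + 4 + g) n) => ig; first by apply: mid_free => //; lia.
  by apply: suf_free => //; move: ig; rewrite /g; case: ifP; lia.
have /dvdnP[m lE] : 4 %| l.
  have [_ finj] := long_is_word n.
  apply: (square_dvd4 (n := n) (f := f) (k := k)) => //.
  by move=> i ki il; exact: (no2 i ltac:(lia)).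
case: (leqP h k) => hk; last first.
  case: (leqP (k + l.*2) 30) => kl30; first by move=> _; apply: (pre_free k l).
  (* The last position a start move may reach. It and [x + 3] lie in the first half, and [80 <= n]
     puts their counterparts in the unmoved middle. *)
  set x := if _ then 0 else 8.
  have x_h : x.+1 = h by rewrite /x /h; case: ifP.
  have x_even : ~~ odd x /\ 4 %| x by rewrite /x; case: ifP.
  have xl : x + 3 < k + l.
    by move: kl30 hk; rewrite /h /x; case: ifP; lia.
  move/negP; apply; apply/eqP; rewrite -pu_lt; try lia.
  have := iso (x - k) (x + 3 - k).
  have -> : k + (x - k) = x by lia.
  have -> : k + (x + 3 - k) = x + 3 by lia.
  move=> -> //; try lia; rewrite mid_lt; try lia.
  have -> : k + l + (x - k) = l + x by lia.
  have -> : k + l + (x + 3 - k) = l + x + 3 by lia.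
  by rewrite layer_lt_mid; lia.
move=> _; case: (leqP (k + l.*2 + g) n) => klg; first exact: (mid_free k l).
move: klg; rewrite /g; case: (boolP (odd n)) => n_odd klg.
  (* The square must end in the moved last letter, which is below the valley three positions
     earlier; its counterpart is above one. *)
  have [u [_ _ /and3P[_ _ viol] u_lt]] := odd_suffix_pattern n80 n_odd.
  have := iso (l - 1) (l - 4) ltac:(lia) ltac:(lia).
  have -> : k + l + (l - 1) = n - 7 + 6 by lia.
  have -> : k + l + (l - 4) = n - 7 + 3 by lia.
  rewrite u_lt // viol mid_lt; try (rewrite ?/g ?n_odd; lia).
  by rewrite n_odd in a_end; rewrite layer_lt_mid; lia.
case: (leqP (n - 57) k) => kn.
  by case: (suf_free k l l2 _ kl iso); rewrite (negbTE n_odd).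
have l20 : 20 <= l by lia.
(* Each [e] marks a middle letter moved above the peak five positions earlier. As these pairs are 8
   apart and [l] is at least 20, one of them lies wholly in the second half. *)
have [e e_in /andP[e1 e2]] : exists2 e, e \in [:: 25; 17; 9] &
    n - e <= k + l.*2 <= n - e + l - 6.
  case: (leqP (k + l.*2 + 11) n) => ?; first by exists 25 => //; lia.
  case: (leqP (k + l.*2 + 3) n) => ?; first by exists 17 => //; lia.
  by exists 9 => //; lia.
have [u [_ _ /and3P[_ _ /allP/(_ e e_in) viol] u_lt]] := suffix_pattern n80 n_odd.
have e8 : 9 <= e <= 25 /\ e %% 8 = 1 by move: e_in; rewrite !inE; lia.
have := iso (n - 6 - e - (k + l)) (n - 1 - e - (k + l)) ltac:(lia) ltac:(lia).
have -> : k + l + (n - 6 - e - (k + l)) = n - 57 + (51 - e) by lia.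
have -> : k + l + (n - 1 - e - (k + l)) = n - 57 + (56 - e) by lia.
rewrite u_lt; try lia; rewrite viol mid_lt; try (rewrite ?/g ?(negbTE n_odd); lia).
rewrite (negbTE n_odd) in a_end; move=> /lexlt_asym/negP; apply.
have -> : a + (k + (n - 6 - e - (k + l))) = a + n - l - 6 - e by lia.
have -> : a + (k + (n - 1 - e - (k + l))) = a + n - l - 1 - e by lia.
by rewrite -/(layer_lt _ _ _) layer_lt_mid; lia.
Qed.

(** * Existence *)

Definition bicrucial_pattern (u : seq nat) : bool :=
  [&& no_square u, saturated u & saturated (rev u)].

Lemma bicrucial_patternP (u : seq nat) : is_word (size u) (nth 0 u) ->
  bicrucial_pattern u -> bicrucial_word (size u) (nth 0 u).
Proof.
move=> uw /and3P[nosq sat rsat]; have [bound _] := uw.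
have u_lt : all (ltn^~ (size u)) u by apply/(all_nthP 0).
split=> //.
- by case=> k [l [l2 kl]]; apply: (@no_squareP u _ 0 k l nosq).
- by apply: (saturatedP _ u_lt) => //; rewrite subnn.
apply: (@saturatedP _ _ (rev u)) => //; rewrite ?size_rev ?all_rev //.
by move=> i j i_u j_u; rewrite subnn !nth_rev.
Qed.

Lemma long_bicrucial (n : nat) : 80 <= n -> bicrucial_word n (long_word n).
Proof.
move=> n80; split.
- exact: long_is_word.
- exact: long_square_free.
- case: (boolP (odd n)) => n_odd.
    have [u [u_size u_lt /and3P[_ sat _] u_rel]] := odd_suffix_pattern n80 n_odd.
    by apply: (@saturatedP _ _ u) => //; rewrite u_size //; lia.
  have [u [u_size u_lt /and3P[_ sat _] u_rel]] := suffix_pattern n80 n_odd.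
  by apply: (@saturatedP _ _ u) => //; rewrite u_size //; lia.
have [u [u_size u_lt /and3P[_ sat _] u_rel]] := prefix_pattern n80.
apply: (@saturatedP _ _ (rev u)) => //; rewrite ?size_rev ?all_rev u_size //.
  by lia.
move=> i j i30 j30; rewrite !nth_rev ?u_size // /flip -u_rel; try lia.
by congr (long_word n _ < long_word n _); lia.
Qed.

(* Lengths 13, 32 and 36, where [long_word] fails; found by a satisfiability search. *)
Definition exceptional_words : seq (seq nat) :=
  [:: [:: 0; 11; 9; 4; 5; 10; 6; 2; 7; 8; 3; 1; 12];
      [:: 28; 30; 31; 23; 22; 26; 29; 27; 18; 24; 25; 15; 12; 17; 21; 19; 13;
          16; 20; 7; 6; 10; 14; 11; 4; 8; 9; 1; 0; 3; 5; 2];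
      [:: 32; 34; 35; 26; 25; 29; 33; 31; 22; 28; 30; 20; 16; 21; 27; 23; 17;
          19; 24; 9; 8; 13; 18; 15; 6; 12; 14; 4; 1; 5; 11; 10; 2; 3; 7; 0]].

Lemma exceptional_bicrucial (u : seq nat) : u \in exceptional_words ->
  bicrucial_word (size u) (nth 0 u).
Proof.
move=> u_in.
have : all (fun u => [&& uniq u, all (ltn^~ (size u)) u & bicrucial_pattern u])
           exceptional_words by vm_compute.
move=> /allP /(_ u u_in) /and3P[u_uniq /(all_nthP 0) u_lt].
apply: bicrucial_patternP; split=> // i j iu ju /eqP.
by rewrite nth_uniq // => /eqP.
Qed.

(** Below 80 the whole word is tested. Lengths 13, 32 and 36 are left to [exceptional_words]. *)
Definition small_lengths : seq nat :=
  [seq n <- iota 9 71 |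
    if odd n then (n == 9) || (15 <= n) else (n == 34) || (40 <= n)].

Lemma small_bicrucial (n : nat) : n \in small_lengths ->
  bicrucial_word n (long_word n).
Proof.
move=> n_in.
have : all (fun n => bicrucial_pattern (ranks (keys (start n) n 0 n)))
           small_lengths by vm_compute.
move=> /allP /(_ n n_in) pat.
have := bicrucial_patternP _ pat; rewrite size_ranks size_keys; apply.
exact: long_is_word.
Qed.

Lemma bicrucial_word_exists (n : nat) :
  n = 9 \/ (odd n /\ 13 <= n) \/ (~~ odd n /\ 32 <= n /\ n <> 38) ->
  exists f, bicrucial_word n f.
Proof.
move=> n_ok; case: (leqP 80 n) => n80.
  by exists (long_word n); apply: long_bicrucial.
have [n13|n13] := eqVneq n 13.
  exists (nth 0 (nth [::] exceptional_words 0)).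
  by rewrite n13; exact: (@exceptional_bicrucial (nth [::] exceptional_words 0) isT).
have [n32|n32] := eqVneq n 32.
  exists (nth 0 (nth [::] exceptional_words 1)).
  by rewrite n32; exact: (@exceptional_bicrucial (nth [::] exceptional_words 1) isT).
have [n36|n36] := eqVneq n 36.
  exists (nth 0 (nth [::] exceptional_words 2)).
  by rewrite n36; exact: (@exceptional_bicrucial (nth [::] exceptional_words 2) isT).
exists (long_word n); apply: small_bicrucial.
by rewrite mem_filter mem_iota; case: (boolP (odd n)) => n_odd; lia.
Qed.

(** * Refutations by case analysis *)

(* Node [i < n] stands for the letter in position [i], and node [n + i] for a new
   letter whose value is just above that letter. *)
Definition node (n : nat) (f : nat -> nat) (x : nat) : nat :=
  if x < n then (f x).*2 else (f (x - n)).*2.+1.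

Lemma node_letter (n : nat) (f : nat -> nat) (i : nat) :
  i < n -> node n f i = (f i).*2.
Proof. by rewrite /node => ->. Qed.

Lemma node_above (n : nat) (f : nat -> nat) (i : nat) :
  node n f (n + i) = (f i).*2.+1.
Proof. by rewrite /node ltnNge leq_addr addKn. Qed.

(* The two halves of the square of length [l.*2] that the letter [n + i] completes
   when it is appended on the right ([side = true]), resp. prepended on the left. *)
Definition first_half (n : nat) (side : bool) (i l : nat) : seq nat :=
  if side then iota (n.+1 - l.*2) l else n + i :: iota 0 l.-1.

Definition second_half (n : nat) (side : bool) (i l : nat) : seq nat :=
  if side then rcons (iota (n.+1 - l) l.-1) (n + i) else iota l.-1 l.

Definition completes (n : nat) (f : nat -> nat) (side : bool) (i l : nat) : Prop :=
  forall p q, p < l -> q < l ->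
    (node n f (nth 0 (first_half n side i l) p) <
     node n f (nth 0 (first_half n side i l) q)) =
    (node n f (nth 0 (second_half n side i l) p) <
     node n f (nth 0 (second_half n side i l) q)).

Definition end_position (n : nat) (side : bool) : nat :=
  if side then n.-1 else 0.

(** The form in which saturation enters the case analysis. When the last step but one goes down, a
    new letter above the last one completes only squares with 4 dividing the half-length; up to
    length 38 these are the four listed. *)
Definition covered (n : nat) (f : nat -> nat) (side : bool) : Prop :=
  forall i, i < n ->
    i = end_position n side \/ f (end_position n side) < f i ->
    exists l, [/\ l \in [:: 4; 8; 12; 16], l.*2 <= n.+1 & completes n f side i l].

(* A derivation of a contradiction from known comparisons between nodes.  [Absent]
   fills the branches of [Cover] whose half-length exceeds the word; [Square k order]
   closes a case because the known comparisons sort both halves at [k] by [order];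
   [Cover side i] distinguishes the half-length (4, 8, 12 or 16) of the square completed
   by the new letter above [i] on that side; [Copy] and [Uncopy] transfer a comparison
   from the first half of such a square to the second and back; [Above i j] derives
   [n + i < j] from [i < j], and [Below i j] derives [j < i] from [j < n + i]. *)
Inductive refutation : Type :=
| Absent
| Cycle of nat & nat
| Square of nat & seq nat
| Compare of nat & nat & refutation & refutation
| Cover of bool & nat & refutation & refutation & refutation & refutation
| Chain of seq nat & refutation
| Copy of bool & nat & nat & nat & nat & refutation
| Uncopy of bool & nat & nat & nat & nat & refutation
| Above of nat & nat & refutation
| Below of nat & nat & refutation.

Definition known (facts : seq (nat * nat)) (a b : nat) : bool :=
  (a, b) \in facts.

Fixpoint refutes (n : nat) (two_sided : bool) (facts : seq (nat * nat))
    (squares : seq (bool * nat * nat)) (r : refutation) : bool :=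
  match r with
  | Absent => false
  | Cycle a b => known facts a b && known facts b a
  | Square k order =>
      let l := size order in
      [&& 2 <= l, k + l.*2 <= n, all (fun i => i \in order) (iota 0 l)
        & sorted (fun i j => known facts (k + i) (k + j) &&
                             known facts (k + l + i) (k + l + j)) order]
  | Compare a b r1 r2 =>
      [&& a != b, a < n, b < n,
          refutes n two_sided ((a, b) :: facts) squares r1
        & refutes n two_sided ((b, a) :: facts) squares r2]
  | Cover side i r4 r8 r12 r16 =>
      let e := end_position n side in
      let closed l r := (l.*2 <= n.+1) ==>
        refutes n two_sided facts ((side, i, l) :: squares) r in
      [&& side || two_sided, i < n, (i == e) || known facts e i,
          closed 4 r4, closed 8 r8, closed 12 r12 & closed 16 r16]
  | Chain path r =>
      if path is a :: p then
        (p != [::]) && path.path (known facts) a p &&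
        refutes n two_sided ((a, last a p) :: facts) squares r
      else false
  | Copy side i l p q r =>
      let s := first_half n side i l in
      let t := second_half n side i l in
      [&& (side, i, l) \in squares, p < l, q < l,
          known facts (nth 0 s p) (nth 0 s q)
        & refutes n two_sided ((nth 0 t p, nth 0 t q) :: facts) squares r]
  | Uncopy side i l p q r =>
      let s := first_half n side i l in
      let t := second_half n side i l in
      [&& (side, i, l) \in squares, p < l, q < l,
          known facts (nth 0 t p) (nth 0 t q)
        & refutes n two_sided ((nth 0 s p, nth 0 s q) :: facts) squares r]
  | Above i j r =>
      [&& i < n, j < n, known facts i j
        & refutes n two_sided ((n + i, j) :: facts) squares r]
  | Below i j r =>
      [&& i < n, j < n, i != j, known facts j (n + i)
        & refutes n two_sided ((j, i) :: facts) squares r]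
  end.

(** Soundness, by induction on the derivation: each rule adds only facts and squares valid in [f].
    Evaluating [refutes] to true thus excludes such an [f]. *)
Lemma refutesP (n : nat) (f : nat -> nat) (two_sided : bool)
    (facts : seq (nat * nat)) (squares : seq (bool * nat * nat)) (r : refutation) :
  (forall i j, i < n -> j < n -> f i = f j -> i = j) ->
  ~ has_square n f ->
  covered n f true -> (two_sided -> covered n f false) ->
  (forall a b, known facts a b -> node n f a < node n f b) ->
  (forall side i l, (side, i, l) \in squares -> completes n f side i l) ->
  ~~ refutes n two_sided facts squares r.
Proof.
move=> finj nosq covR covL; have cov side : side || two_sided -> covered n f side.
  by case: side.
have consP F a b : node n f a < node n f b ->
    (forall a b, known F a b -> node n f a < node n f b) ->
    forall c d, known ((a, b) :: F) c d -> node n f c < node n f d.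
  by move=> ab FP c d; rewrite /known inE => /orP[/eqP[-> ->] //|/FP].
elim: r facts squares => [|a b|k order|a b r1 IH1 r2 IH2
  |side i r4 IH4 r8 IH8 r12 IH12 r16 IH16|[|a p] r IH|side i l p q r IH
  |side i l p q r IH|i j r IH|i j r IH] F S FP SP //=; apply/negP.
- by case/andP=> /FP ab /FP; lia.
- set l := size order; case/and4P=> l2 kl /allP all_in srt; apply: nosq.
  exists k, l; split=> // i j il jl.
  (* One order sorting both halves at once shows that their patterns agree. *)
  pose R x y := (node n f (k + x) < node n f (k + y)) &&
                (node n f (k + l + x) < node n f (k + l + y)).
  have Rtrans : transitive R.
    by move=> y x z /andP[h1 h2] /andP[h3 h4]; apply/andP; split; lia.
  have Rsrt : sorted R order.
    by apply: sub_sorted srt => x y /andP[/FP h1 /FP h2]; apply/andP.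
  have Rf x y : x < l -> y < l -> R x y ->
      f (k + x) < f (k + y) /\ f (k + l + x) < f (k + l + y).
    move=> xl yl; rewrite /R /node !ifT; lia.
  have in_order x : x < l -> x \in order by move=> xl; apply: all_in; rewrite mem_iota.
  case: (ltngtP (index i order) (index j order)) => ij.
  - have := sorted_ltn_nth Rtrans 0 Rsrt; move/(_ (index i order) (index j order)).
    rewrite !inE !index_mem !nth_index ?in_order // => /(_ isT isT ij) /Rf; lia.
  - have := sorted_ltn_nth Rtrans 0 Rsrt; move/(_ (index j order) (index i order)).
    rewrite !inE !index_mem !nth_index ?in_order // => /(_ isT isT ij) /Rf; lia.
  have <- : i = j by rewrite -(nth_index 0 (in_order i il)) ij nth_index ?in_order.
  by rewrite !ltnn.
- case/and5P=> ab an bn r1P r2P; have fab : f a <> f b.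
    by move/(finj _ _ an bn)/eqP; rewrite (negbTE ab).
  have nodeab : node n f a < node n f b \/ node n f b < node n f a.
    by rewrite /node an bn; lia.
  case: nodeab => nab.
    by move: (IH1 ((a, b) :: F) S (consP _ _ _ nab FP) SP); rewrite r1P.
  by move: (IH2 ((b, a) :: F) S (consP _ _ _ nab FP) SP); rewrite r2P.
- case/and5P=> /cov sideP i_n i_e c4 /and3P[c8 c12 c16].
  have e_n : end_position n side < n by rewrite /end_position; case: (side); lia.
  have e_i : i = end_position n side \/ f (end_position n side) < f i.
    by case/orP: i_e => [/eqP|/FP]; [left|rewrite /node i_n e_n ltn_double; right].
  have [l [l_in l_n li]] := sideP i i_n e_i.
  have SP' side' i' l' : (side', i', l') \in (side, i, l) :: S ->
      completes n f side' i' l'.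
    by rewrite inE => /orP[/eqP[-> -> ->] //|/SP].
  move: l_in; rewrite !inE => /or4P[] /eqP l_eq; subst l.
  - by move: (IH4 F _ FP SP'); rewrite (implyP c4).
  - by move: (IH8 F _ FP SP'); rewrite (implyP c8).
  - by move: (IH12 F _ FP SP'); rewrite (implyP c12).
  by move: (IH16 F _ FP SP'); rewrite (implyP c16).
- case/andP=> /andP[p0 pP] rP.
  have ab : node n f a < node n f (last a p).
    have : path.path (fun x y => node n f x < node n f y) a p.
      by apply: sub_path pP => x y /FP.
    rewrite (path_sortedE (fun y x z => @ltn_trans _ _ _)).
    by move=> /andP[/allP + _]; apply; case: (p) p0 => // b q _; apply: mem_last.
  by move: (IH ((a, last a p) :: F) S (consP _ _ _ ab FP) SP); rewrite rP.
- case/and5P=> /SP spP pl ql /FP pq rP; rewrite spP // in pq.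
  by move: (IH _ S (consP _ _ _ pq FP) SP); rewrite rP.
- case/and5P=> /SP spP pl ql /FP pq rP; rewrite -spP // in pq.
  by move: (IH _ S (consP _ _ _ pq FP) SP); rewrite rP.
- case/and4P=> i_n j_n /FP ij rP.
  have nij : node n f (n + i) < node n f j.
    by move: ij; rewrite node_above !node_letter //; lia.
  by move: (IH _ S (consP _ _ _ nij FP) SP); rewrite rP.
case/and5P=> i_n j_n ij /FP ji rP.
have fij : f i <> f j by move/(finj _ _ i_n j_n)/eqP; rewrite (negbTE ij).
have nji : node n f j < node n f i.
  by move: ji; rewrite node_above !node_letter //; lia.
by move: (IH _ S (consP _ _ _ nji FP) SP); rewrite rP.
Qed.

(** * Letters that complete squares *)

(* The new last letter is placed just above the letter in position [i]. *)
Definition extend (n : nat) (f : nat -> nat) (i j : nat) : nat :=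
  if j < n then f j + (f i < f j) else (f i).+1.

Lemma extend_is_word (n : nat) (f : nat -> nat) (i : nat) :
  i < n -> is_word n f -> is_word n.+1 (extend n f i).
Proof.
move=> i_n [fn finj]; have fi := fn i i_n.
split=> [j j_n|j k j_n k_n]; rewrite /extend.
  by case: ifP => [/fn|]; lia.
case: ifP => jn; case: ifP => kn; try lia.
by move=> fjk; apply: finj => //; lia.
Qed.

Lemma extend_lt (n : nat) (f : nat -> nat) (i j k : nat) : j < n -> k < n ->
  (extend n f i j < extend n f i k) = (f j < f k).
Proof. by move=> jn kn; rewrite /extend jn kn; lia. Qed.

Lemma extend_lt_node (n : nat) (f : nat -> nat) (i j k : nat) : j <= n -> k <= n ->
  let x m := if m < n then m else n + i in
  (extend n f i j < extend n f i k) = (node n f (x j) < node n f (x k)).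
Proof.
move=> jn kn /=; rewrite /extend.
by case: (ltnP j n) => ?; case: (ltnP k n) => ?;
  rewrite ?node_above ?node_letter //; lia.
Qed.

(** A square avoiding the new letter would lie in [f], so the square ends in the new letter. *)
Lemma extend_square (n : nat) (f : nat -> nat) (i : nat) : i < n ->
  is_word n f -> ~ has_square n f -> right_saturated n f ->
  exists l, [/\ 2 <= l, l.*2 <= n.+1 &
    same_order (extend n f i) (n.+1 - l.*2) (n.+1 - l) l].
Proof.
move=> i_n fw nosq sat.
have [||k [l [l2 kl iso]]] := sat (extend n f i).
- exact: extend_is_word.
- by move=> j k j_n k_n; apply: extend_lt.
have kl' : k + l.*2 = n.+1.
  case: (ltnP n (k + l.*2)) => [|kn]; first by lia.
  case: nosq; exists k, l; split=> // x y xl yl.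
  by have := iso x y xl yl; rewrite !extend_lt //; lia.
exists l; split=> //; first by lia.
have -> : n.+1 - l.*2 = k by lia.
by have -> : n.+1 - l = k + l by lia.
Qed.

Lemma no_square2_step (n : nat) (f : nat -> nat) (k : nat) :
  (forall i j, i < n -> j < n -> f i = f j -> i = j) -> ~ has_square n f ->
  k.+3 < n -> (f k.+2 < f k.+3) = ~~ (f k < f k.+1).
Proof.
move=> finj nosq kn.
have [//|eq_up] := eqVneq (f k.+2 < f k.+3) (~~ (f k < f k.+1)).
case: nosq; exists k, 2; split=> //; first by lia.
have ne x : x.+1 < n -> f x.+1 <> f x by move=> xn /finj; lia.
have := ne k; have := ne k.+2; move=> ne2 ne0.
move=> [|[|//]] [|[|//]] _ _; rewrite ?addn0 ?addn1 ?addn2 ?ltnn //.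
  by move: eq_up; case: (f k < _); case: (f k.+2 < _).
by move: eq_up; lia.
Qed.

(** The last step but one goes down and the new step goes up, so the new letter completes no square
    of half-length 2. *)
Lemma extend_square_dvd4 (n : nat) (f : nat -> nat) (i l : nat) : i < n ->
  is_word n f -> ~ has_square n f -> f n.-2 < f (n - 3) -> f n.-1 <= f i ->
  2 <= l -> l.*2 <= n.+1 ->
  same_order (extend n f i) (n.+1 - l.*2) (n.+1 - l) l -> 4 %| l.
Proof.
move=> i_n fw nosq down fi l2 ln iso.
have [_ ginj] := extend_is_word i_n fw.
apply: (@square_dvd4 n.+1 (extend n f i) (n.+1 - l.*2)) => //.
- move=> j _ j4 iso2; case: (ltnP (j + 3) n) => j3.
    apply: nosq; exists j, 2; split=> // [|x y x2 y2]; first by lia.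
    by have := iso2 x y x2 y2; rewrite !extend_lt //; lia.
  have := iso2 0 1 isT isT.
  have -> : j + 0 = n - 3 by lia.
  have -> : j + 1 = n.-2 by lia.
  have -> : j + 2 + 0 = n.-1 by lia.
  have -> : j + 2 + 1 = n by lia.
  have -> : extend n f i n.-1 < extend n f i n by rewrite /extend ltnn ifT; lia.
  by rewrite extend_lt; lia.
- by lia.
by have -> : n.+1 - l.*2 + l = n.+1 - l by lia.
Qed.

Lemma nth_first_half (n i l p : nat) : p < l -> l.*2 <= n.+1 ->
  nth 0 (first_half n true i l) p = n.+1 - l.*2 + p.
Proof. by move=> pl ln; rewrite nth_iota. Qed.

Lemma nth_second_half (n i l p : nat) : p < l -> l.*2 <= n.+1 ->
  nth 0 (second_half n true i l) p = if p.+1 < l then n.+1 - l + p else n + i.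
Proof.
move=> pl ln; rewrite nth_rcons size_iota ltn_predRL.
case: (ltnP p.+1 l) => pl'; first by rewrite nth_iota //; lia.
by rewrite ifT //; lia.
Qed.

Lemma saturated_covered (n : nat) (f : nat -> nat) : 3 <= n <= 38 ->
  is_word n f -> ~ has_square n f -> right_saturated n f ->
  f n.-2 < f (n - 3) -> covered n f true.
Proof.
move=> n_bounds fw nosq sat down i i_n i_end.
have fi : f n.-1 <= f i by case: i_end => [->|/ltnW].
have [l [l2 ln iso]] := extend_square i_n fw nosq sat.
have /dvdnP[m l_eq] := extend_square_dvd4 i_n fw nosq down fi l2 ln iso.
exists l; split=> //; first by rewrite !inE; lia.
move=> p q pl ql; rewrite !nth_first_half // !nth_second_half //.
have := iso p q pl ql; rewrite !extend_lt_node; try lia.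
have e1 x : x < l -> (n.+1 - l.*2 + x < n) = true by lia.
have e2 x : x < l -> (n.+1 - l + x < n) = (x.+1 < l) by lia.
by rewrite !e1 // !e2.
Qed.

(** Reversal exchanges the two halves of a square and reverses each, whence the offsets
    [l - p.+1]. *)
Lemma covered_flip (n : nat) (f : nat -> nat) :
  covered n (flip n f) true -> covered n f false.
Proof.
move=> cov i i_n i_end; have [||l [l_in ln comp]] := cov (n - i.+1).
- by lia.
- rewrite /end_position /flip /= in i_end *.
  have -> : n - (n - i.+1).+1 = i by lia.
  case: i_end => [->|fi]; first by left; lia.
  by right; have -> : n - n.-1.+1 = 0 by lia.
have l4 : 4 <= l by move: l_in; rewrite !inE; lia.
exists l; split=> //; pose x p := if p is p'.+1 then p' else n + i.
have firstE p : p < l -> nth 0 (first_half n false i l) p = x p.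
  by case: p => //= p pl; rewrite nth_iota; lia.
have secondE p : p < l -> nth 0 (second_half n false i l) p = l.-1 + p.
  by move=> pl; rewrite nth_iota.
have flip_first p : p < l ->
    node n (flip n f) (nth 0 (first_half n true (n - i.+1) l) (l - p.+1)) =
    node n f (l.-1 + p).
  move=> pl; rewrite nth_first_half; try lia; rewrite !node_letter /flip; try lia.
  by congr (f _).*2; lia.
have flip_second p : p < l ->
    node n (flip n f) (nth 0 (second_half n true (n - i.+1) l) (l - p.+1)) =
    node n f (x p).
  case: p => [|p] pl; rewrite nth_second_half; try lia.
    rewrite ifF; last by lia.
    by rewrite !node_above /flip; congr (f _).*2.+1; lia.
  rewrite ifT; last by lia.
  by rewrite /= !node_letter /flip; try lia; congr (f _).*2; lia.
move=> p q pl ql; rewrite !firstE // !secondE //.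
by rewrite -!flip_first // -!flip_second //; apply/esym/comp; lia.
Qed.

(** A square completed on the right uses [2 * l - 1] old letters, so a suffix holding the longest
    possible one inherits the whole condition. *)
Lemma covered_suffix (n q : nat) (f : nat -> nat) : 0 < q <= n ->
  (forall l, l \in [:: 4; 8; 12; 16] -> l.*2 <= n.+1 -> l.*2 <= q.+1) ->
  covered n f true -> covered q (fun j => f (n - q + j)) true.
Proof.
move=> qn short cov i i_q i_end; have [||l [l_in ln comp]] := cov (n - q + i).
- by lia.
- move: i_end; rewrite /end_position /= (_ : n - q + q.-1 = n.-1); last by lia.
  by case=> [->|]; [left; lia | right].
have lq := short l l_in ln; exists l; split=> // p r pl rl.
have := comp p r pl rl; rewrite !nth_first_half // !nth_second_half //.
have pos x y : x < q -> y = n - q + x ->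
    node n f y = node q (fun j => f (n - q + j)) x.
  by move=> xq ->; rewrite !node_letter //; lia.
have first x : x < l -> node n f (n.+1 - l.*2 + x) =
    node q (fun j => f (n - q + j)) (q.+1 - l.*2 + x).
  by move=> xl; apply: pos; lia.
have second x : x < l -> node n f (if x.+1 < l then n.+1 - l + x else n + (n - q + i)) =
    node q (fun j => f (n - q + j)) (if x.+1 < l then q.+1 - l + x else q + i).
  by move=> xl; case: ifP => ?; [apply: pos; lia | rewrite !node_above].
by rewrite !first // !second.
Qed.

(** * Nonexistence *)

Definition compl (n : nat) (f : nat -> nat) (i : nat) : nat := n.-1 - f i.

Lemma compl_lt (n : nat) (f : nat -> nat) (i j : nat) : is_word n f ->
  i < n -> j < n -> (compl n f i < compl n f j) = (f j < f i).
Proof. by move=> [fn _] /fn fi /fn fj; rewrite /compl; lia. Qed.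

Lemma is_word_compl (n : nat) (f : nat -> nat) : is_word n f -> is_word n (compl n f).
Proof.
move=> [fn finj]; split=> [i /fn|i j i_n j_n]; rewrite /compl; first by lia.
by move=> e; apply: finj => //; have := fn i i_n; have := fn j j_n; lia.
Qed.

Lemma has_square_compl (n : nat) (f : nat -> nat) : is_word n f ->
  has_square n (compl n f) -> has_square n f.
Proof.
move=> fw [k [l [l2 kl iso]]]; exists k, l; split=> // i j il jl.
by have := iso j i jl il; rewrite !compl_lt //; lia.
Qed.

Lemma right_saturated_compl (n : nat) (f : nat -> nat) : is_word n f ->
  right_saturated n f -> right_saturated n (compl n f).
Proof.
move=> fw sat g gw gf; apply: has_square_compl => //.
apply: sat => [|i j i_n j_n]; first exact: is_word_compl.
by rewrite compl_lt ?gf ?compl_lt //; lia.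
Qed.

Lemma bicrucial_compl (n : nat) (f : nat -> nat) :
  bicrucial_word n f -> bicrucial_word n (compl n f).
Proof.
case=> fw nosq satr satl; split.
- exact: is_word_compl.
- by move/(has_square_compl fw).
- exact: right_saturated_compl.
by apply: (@right_saturated_compl n (flip n f)) => //; apply: is_word_flip.
Qed.

Lemma bicrucial_flip (n : nat) (f : nat -> nat) :
  bicrucial_word n f -> bicrucial_word n (flip n f).
Proof.
case=> fw nosq satr satl; split=> //; first exact: is_word_flip.
  by move/has_square_flip.
by apply: right_saturated_eq satr => i j i_n j_n; rewrite !flipK.
Qed.

(** Steps two apart are opposite, so the last two determine all; [m] counts steps back from the
    last. *)
Lemma step_from_end (n : nat) (f : nat -> nat) (m : nat) :
  (forall i j, i < n -> j < n -> f i = f j -> i = j) -> ~ has_square n f ->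
  m + 2 <= n ->
  (f (n - m.+2) < f (n - m.+1)) =
  (if odd m then f (n - 3) < f n.-2 else f n.-2 < f n.-1) (+) odd m./2.
Proof.
move=> finj nosq; elim/ltn_ind: m => -[|[|m]] IH mn.
- by rewrite /= addbF subn1 subn2.
- by rewrite /= addbF subn2.
have := IH m ltac:(lia) ltac:(lia); rewrite /= negbK addbN => <-.
have := @no_square2_step n f (n - m.+4) finj nosq ltac:(lia).
have -> : (n - m.+4).+3 = n - m.+1 by lia.
have -> : (n - m.+4).+2 = n - m.+2 by lia.
have -> : (n - m.+4).+1 = n - m.+3 by lia.
by move=> ->; rewrite negbK.
Qed.

(* For words whose last step but one goes down. *)
Definition step_facts (n : nat) (last_up : bool) : seq (nat * nat) :=
  [seq let m := n - k.+2 in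
       if (last_up && ~~ odd m) (+) odd m./2 then (k, k.+1) else (k.+1, k)
  | k <- iota 0 n.-1] ++ [seq (i, n + i) | i <- iota 0 n].

Lemma step_factsP (n : nat) (f : nat -> nat) (a b : nat) : 3 <= n ->
  (forall i j, i < n -> j < n -> f i = f j -> i = j) -> ~ has_square n f ->
  f n.-2 < f (n - 3) -> known (step_facts n (f n.-2 < f n.-1)) a b -> node n f a < node n f b.
Proof.
move=> n3 finj nosq down; rewrite /known mem_cat; case/orP => /mapP[k];
  rewrite mem_iota => k_n; last first.
  by case=> -> ->; rewrite node_above node_letter //; lia.
set m := n - k.+2; have := @step_from_end n f m finj nosq ltac:(lia).
have -> : n - m.+2 = k by lia.
have -> : n - m.+1 = k.+1 by lia.
rewrite (_ : (f (n - 3) < _) = false) //=; last by lia.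
rewrite (_ : (if odd m then _ else _) = (f n.-2 < f n.-1) && ~~ odd m); last first.
  by case: (odd m); rewrite ?andbF ?andbT.
have ne : f k.+1 <> f k by move/finj; lia.
by case: (_ (+) _) => up [-> ->]; rewrite !node_letter; lia.
Qed.

(** Suffixes of 7, 15 and 23 letters are what half-lengths up to 4, 8 and 12 involve. These three
    derivations assume that the last two steps go down. *)
Definition suffix7_refutation : refutation :=
  Above 6 5 (Cover true 6 (Uncopy true 6 4 3 1 (Cover true 5 (Uncopy true 5 4
  1 3 (Cycle 1 3)) Absent Absent Absent)) Absent Absent Absent).

Definition suffix15_refutation : refutation :=
  Chain [:: 14; 13; 12] (Above 13 12 (Above 14 13 (Chain [:: 29; 13; 12]
  (Cover true 14 (Uncopy true 14 4 3 0 (Uncopy true 14 4 3 1 (Cover true 13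
  (Uncopy true 13 4 1 3 (Cycle 9 11)) (Uncopy true 13 8 7 4 (Cover true 12
  (Uncopy true 12 4 0 3 (Cycle 8 11)) (Uncopy true 12 8 4 7 (Cycle 4 7))
  Absent Absent)) Absent Absent))) (Uncopy true 14 8 7 4 (Uncopy true 14 8 7 5
  (Cover true 13 (Uncopy true 13 4 3 0 (Cover true 12 (Uncopy true 12 4 0 3
  (Cycle 8 11)) (Uncopy true 12 8 4 7 (Cycle 4 7)) Absent Absent)) (Uncopy
  true 13 8 5 7 (Cycle 5 7)) Absent Absent))) Absent Absent)))).

Definition suffix23_refutation : refutation :=
  Chain [:: 22; 21; 20] (Above 21 20 (Above 22 21 (Chain [:: 45; 21; 20]
  (Cover true 22 (Uncopy true 22 4 3 0 (Uncopy true 22 4 3 1 (Cover true 21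
  (Uncopy true 21 4 1 3 (Cycle 17 19)) (Uncopy true 21 8 3 0 (Uncopy true 21 8
  7 4 (Cover true 20 (Uncopy true 20 4 0 3 (Cycle 16 19)) (Uncopy true 20 8 4
  7 (Cycle 12 15)) (Uncopy true 20 12 8 11 (Cycle 8 11)) Absent))) (Uncopy
  true 21 12 9 11 (Uncopy true 21 12 11 8 (Cover true 20 (Uncopy true 20 4 0 3
  (Cycle 16 19)) (Copy true 20 8 1 3 (Cycle 17 19)) (Uncopy true 20 12 8 11
  (Cycle 8 11)) Absent))) Absent))) (Uncopy true 22 8 7 4 (Uncopy true 22 8 7
  5 (Cover true 21 (Uncopy true 21 4 3 0 (Uncopy true 22 8 3 0 (Cover true 20
  (Uncopy true 20 4 0 3 (Cycle 16 19)) (Uncopy true 20 8 4 7 (Cycle 12 15))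
  (Uncopy true 20 12 8 11 (Cycle 8 11)) Absent))) (Uncopy true 21 8 5 7 (Cycle
  13 15)) (Uncopy true 21 12 9 11 (Uncopy true 21 12 11 8 (Copy true 22 8 1 3
  (Copy true 22 8 3 0 (Uncopy true 21 12 5 7 (Uncopy true 21 12 7 4 (Square 4
  [:: 2; 1; 3; 0]))))))) Absent))) (Uncopy true 22 12 11 8 (Uncopy true 22 12
  11 9 (Cover true 21 (Uncopy true 21 4 1 3 (Uncopy true 21 4 3 0 (Cover true
  20 (Uncopy true 20 4 0 3 (Cycle 16 19)) (Uncopy true 20 8 1 3 (Cycle 9 11))
  (Uncopy true 20 12 8 11 (Cycle 8 11)) Absent))) (Copy true 21 8 3 1 (Uncopy
  true 22 12 7 5 (Square 4 [:: 2; 3; 1; 0]))) (Uncopy true 21 12 9 11 (Cycle 9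
  11)) Absent))) Absent)))).

(** For lengths 7 and 11 the last step goes up after a descent, and both ends are used. *)
Definition word7_refutation : refutation :=
  Cover true 6 (Cover false 0 (Compare 0 2 (Above 0 2 (Copy false 0 4 0 3
  (Cover false 2 (Uncopy false 2 4 0 3 (Cycle 9 2)) Absent Absent Absent)))
  (Copy true 6 4 2 0 (Above 6 4 (Uncopy true 6 4 3 0 (Cover true 4 (Uncopy
  true 4 4 0 3 (Cycle 0 3)) Absent Absent Absent))))) Absent Absent Absent)
  Absent Absent Absent.

Definition word11_refutation : refutation :=
  Cover true 10 (Cover false 0 (Compare 0 2 (Copy false 0 4 1 3 (Square 0 [::
  1; 0; 2; 3])) (Copy false 0 4 3 1 (Copy true 10 4 2 0 (Square 3 [:: 2; 3; 1;
  0])))) Absent Absent Absent) Absent Absent Absent.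

(** For the new letters above positions 37, 36, 35, the half-lengths 4, 8, 16 and 4, 16, 8 need a
    new first letter, [Cover false 0]; all other combinations are closed from the right. *)
Definition word38_refutation : refutation :=
  Chain [:: 37; 36; 35] (Above 34 35 (Above 36 35 (Above 37 36 (Chain [:: 75;
  36; 35] (Cover true 37 (Uncopy true 37 4 3 0 (Uncopy true 37 4 3 1 (Cover
  true 36 (Uncopy true 36 4 1 3 (Cycle 32 34)) (Uncopy true 36 8 3 0 (Uncopy
  true 36 8 3 1 (Uncopy true 36 8 5 7 (Uncopy true 36 8 7 4 (Cover true 35
  (Uncopy true 35 4 0 3 (Cycle 31 34)) (Uncopy true 35 8 4 7 (Cycle 27 30))
  (Uncopy true 35 12 8 11 (Cycle 23 26)) (Uncopy true 35 16 3 0 (Uncopy true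
  35 16 3 1 (Uncopy true 35 16 11 9 (Uncopy true 35 16 12 15 (Cover false 0
  (Compare 0 2 (Copy false 0 4 1 3 (Square 0 [:: 1; 0; 2; 3])) (Copy false 0 4
  3 1 (Square 3 [:: 2; 3; 1; 0]))) (Compare 4 2 (Copy false 0 8 5 3 (Copy true
  35 16 5 3 (Copy true 36 8 5 3 (Chain [:: 37; 36; 34] (Chain [:: 36; 34; 72]
  (Above 36 34 (Uncopy true 36 8 7 3 (Cover true 34 (Uncopy true 34 4 1 3
  (Cycle 32 34)) (Uncopy true 34 8 3 7 (Cycle 26 30)) (Uncopy true 34 12 1 3
  (Cycle 16 18)) (Copy true 34 16 12 15 (Cycle 35 72)))))))))) (Copy false 0 8
  3 5 (Copy true 35 16 3 5 (Copy true 36 8 3 5 (Uncopy true 35 16 11 13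
  (Compare 6 8 (Square 1 [:: 0; 1; 3; 2]) (Compare 14 16 (Square 9 [:: 0; 1;
  3; 2]) (Compare 0 5 (Above 0 5 (Copy false 0 8 0 6 (Copy true 35 16 0 6
  (Copy true 36 8 0 6 (Uncopy true 35 16 8 14 (Square 6 [:: 3; 4; 2; 0; 1; 7;
  6; 5])))))) (Copy false 0 8 6 1 (Copy true 35 16 6 1 (Copy true 36 8 6 1
  (Uncopy true 35 16 14 9 (Compare 0 4 (Above 0 4 (Copy false 0 8 0 5 (Copy
  true 35 16 0 5 (Copy true 36 8 0 5 (Uncopy true 35 16 8 13 (Compare 13 9
  (Copy true 35 16 6 2 (Copy true 36 8 6 2 (Uncopy true 35 16 14 10 (Square 6
  [:: 7; 3; 4; 2; 0; 1; 6; 5])))) (Copy true 35 16 2 6 (Copy true 36 8 2 6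
  (Uncopy true 35 16 10 14 (Compare 2 5 (Copy false 0 8 3 6 (Copy true 35 16 3
  6 (Copy true 36 8 3 6 (Uncopy true 35 16 11 14 (Square 6 [:: 3; 4; 7; 2; 0;
  1; 6; 5]))))) (Copy false 0 8 6 3 (Copy true 35 16 6 3 (Copy true 36 8 6 3
  (Uncopy true 35 16 14 11 (Square 6 [:: 3; 7; 4; 2; 0; 1; 6;
  5]))))))))))))))) (Copy false 0 8 5 1 (Copy true 35 16 5 1 (Copy true 36 8 5
  1 (Uncopy true 35 16 13 9 (Compare 3 0 (Copy false 0 8 4 1 (Copy true 35 16
  4 1 (Copy true 36 8 4 1 (Uncopy true 35 16 12 9 (Compare 13 9 (Copy true 35
  16 6 2 (Copy true 36 8 6 2 (Uncopy true 35 16 14 10 (Square 6 [:: 7; 3; 4;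
  6; 5; 2; 0; 1])))) (Copy true 35 16 2 6 (Copy true 36 8 2 6 (Uncopy true 35
  16 10 14 (Compare 10 13 (Copy true 35 16 3 6 (Copy true 36 8 3 6 (Uncopy
  true 35 16 11 14 (Square 6 [:: 3; 4; 7; 6; 5; 2; 0; 1])))) (Copy true 35 16
  6 3 (Copy true 36 8 6 3 (Uncopy true 35 16 14 11 (Square 6 [:: 3; 7; 4; 6;
  5; 2; 0; 1]))))))))))))) (Above 0 3 (Copy false 0 8 0 4 (Copy true 35 16 0 4
  (Copy true 36 8 0 4 (Uncopy true 35 16 8 12 (Compare 13 9 (Copy true 35 16 6
  2 (Copy true 36 8 6 2 (Uncopy true 35 16 14 10 (Square 6 [:: 7; 3; 4; 6; 2;
  0; 1; 5])))) (Copy true 35 16 2 6 (Copy true 36 8 2 6 (Uncopy true 35 16 10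
  14 (Compare 10 13 (Copy true 35 16 3 6 (Copy true 36 8 3 6 (Uncopy true 35
  16 11 14 (Square 6 [:: 3; 4; 7; 6; 2; 0; 1; 5])))) (Copy true 35 16 6 3
  (Copy true 36 8 6 3 (Uncopy true 35 16 14 11 (Square 6 [:: 3; 7; 4; 6; 2; 0;
  1; 5])))))))))))))))))))))))))))))))) (Uncopy false 0 12 8 11 (Cycle 7 10))
  (Compare 4 2 (Copy false 0 16 5 3 (Copy true 35 16 13 11 (Chain [:: 37; 36;
  34] (Chain [:: 36; 34; 72] (Above 36 34 (Uncopy true 36 8 7 3 (Cover true 34
  (Uncopy true 34 4 1 3 (Cycle 32 34)) (Uncopy true 34 8 3 7 (Cycle 26 30))
  (Uncopy true 34 12 1 3 (Cycle 16 18)) (Copy true 34 16 12 15 (Cycle 35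
  72))))))))) (Copy false 0 16 3 5 (Copy true 35 16 11 13 (Uncopy true 36 8 3
  5 (Uncopy true 35 16 3 5 (Compare 6 8 (Square 1 [:: 0; 1; 3; 2]) (Compare 14
  16 (Square 9 [:: 0; 1; 3; 2]) (Compare 0 5 (Above 0 5 (Copy false 0 16 0 6
  (Copy true 35 16 8 14 (Uncopy true 36 8 0 6 (Uncopy true 35 16 0 6 (Square 6
  [:: 3; 4; 2; 0; 1; 7; 6; 5])))))) (Copy false 0 16 6 1 (Copy true 35 16 14 9
  (Uncopy true 36 8 6 1 (Uncopy true 35 16 6 1 (Compare 3 0 (Copy false 0 16 4
  1 (Copy true 35 16 12 9 (Uncopy true 36 8 4 1 (Uncopy true 35 16 4 1
  (Compare 13 9 (Copy true 35 16 6 2 (Copy true 36 8 6 2 (Uncopy true 35 16 14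
  10 (Square 6 [:: 7; 3; 4; 6; 5; 2; 0; 1])))) (Copy true 35 16 2 6 (Copy true
  36 8 2 6 (Uncopy true 35 16 10 14 (Compare 10 13 (Copy true 35 16 3 6 (Copy
  true 36 8 3 6 (Uncopy true 35 16 11 14 (Square 6 [:: 3; 4; 7; 6; 5; 2; 0;
  1])))) (Copy true 35 16 6 3 (Copy true 36 8 6 3 (Uncopy true 35 16 14 11
  (Square 6 [:: 3; 7; 4; 6; 5; 2; 0; 1]))))))))))))) (Above 0 3 (Copy false 0
  16 0 4 (Copy true 35 16 8 12 (Uncopy true 36 8 0 4 (Uncopy true 35 16 0 4
  (Compare 0 4 (Above 0 4 (Copy false 0 16 0 5 (Copy true 35 16 8 13 (Uncopy
  true 36 8 0 5 (Uncopy true 35 16 0 5 (Compare 13 9 (Copy true 35 16 6 2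
  (Copy true 36 8 6 2 (Uncopy true 35 16 14 10 (Square 6 [:: 7; 3; 4; 2; 0; 1;
  6; 5])))) (Copy true 35 16 2 6 (Copy true 36 8 2 6 (Uncopy true 35 16 10 14
  (Compare 10 13 (Copy true 35 16 3 6 (Copy true 36 8 3 6 (Uncopy true 35 16
  11 14 (Square 6 [:: 3; 4; 7; 2; 0; 1; 6; 5])))) (Copy true 35 16 6 3 (Copy
  true 36 8 6 3 (Uncopy true 35 16 14 11 (Square 6 [:: 3; 7; 4; 2; 0; 1; 6;
  5])))))))))))))) (Copy false 0 16 5 1 (Copy true 35 16 13 9 (Uncopy true 36
  8 5 1 (Uncopy true 35 16 5 1 (Compare 13 9 (Copy true 35 16 6 2 (Copy true
  36 8 6 2 (Uncopy true 35 16 14 10 (Square 6 [:: 7; 3; 4; 6; 2; 0; 1; 5]))))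
  (Copy true 35 16 2 6 (Copy true 36 8 2 6 (Uncopy true 35 16 10 14 (Compare
  10 13 (Copy true 35 16 3 6 (Copy true 36 8 3 6 (Uncopy true 35 16 11 14
  (Square 6 [:: 3; 4; 7; 6; 2; 0; 1; 5])))) (Copy true 35 16 6 3 (Copy true 36
  8 6 3 (Uncopy true 35 16 14 11 (Square 6 [:: 3; 7; 4; 6; 2; 0; 1;
  5])))))))))))))))))))))))))))))))))))))))))) (Uncopy true 36 12 7 4 (Uncopy
  true 36 12 9 11 (Uncopy true 36 12 11 8 (Cover true 35 (Uncopy true 35 4 0 3
  (Cycle 31 34)) (Copy true 35 8 1 3 (Cycle 32 34)) (Uncopy true 35 12 8 11
  (Cycle 23 26)) (Uncopy true 35 16 12 15 (Cycle 19 22)))))) (Uncopy true 36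
  16 11 8 (Uncopy true 36 16 11 9 (Uncopy true 36 16 13 15 (Uncopy true 36 16
  15 12 (Cover true 35 (Uncopy true 35 4 0 3 (Cycle 31 34)) (Uncopy true 35 8
  3 1 (Uncopy true 35 8 4 7 (Uncopy true 36 16 3 1 (Uncopy true 36 16 4 7
  (Cover false 0 (Compare 0 2 (Copy false 0 4 1 3 (Square 0 [:: 1; 0; 2; 3]))
  (Copy false 0 4 3 1 (Square 3 [:: 2; 3; 1; 0]))) (Uncopy false 0 8 3 1
  (Uncopy false 0 8 4 7 (Compare 4 2 (Copy false 0 8 5 3 (Copy true 36 16 5 3
  (Copy true 35 8 5 3 (Chain [:: 37; 36; 34] (Chain [:: 36; 34; 72] (Above 36
  34 (Uncopy true 36 16 15 11 (Cover true 34 (Uncopy true 34 4 1 3 (Cycle 32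
  34)) (Copy true 34 8 4 7 (Cycle 35 72)) (Uncopy true 34 12 0 3 (Cycle 15
  18)) (Uncopy true 34 16 11 15 (Cycle 18 22)))))))))) (Copy false 0 8 3 5
  (Copy true 36 16 3 5 (Copy true 35 8 3 5 (Uncopy true 36 16 11 13 (Compare 6
  8 (Square 1 [:: 0; 1; 3; 2]) (Compare 14 16 (Square 9 [:: 0; 1; 3; 2])
  (Compare 0 5 (Copy false 0 8 1 6 (Square 0 [:: 1; 2; 0; 5; 4; 3; 6; 7]))
  (Copy false 0 8 6 1 (Compare 3 0 (Copy false 0 8 4 1 (Copy true 36 16 4 1
  (Copy true 35 8 4 1 (Uncopy true 36 16 12 9 (Compare 13 9 (Copy true 36 16 6
  2 (Copy true 35 8 6 2 (Uncopy true 36 16 14 10 (Square 6 [:: 7; 3; 4; 6; 5;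
  2; 0; 1])))) (Copy true 36 16 2 6 (Copy true 35 8 2 6 (Uncopy true 36 16 10
  14 (Compare 2 5 (Copy false 0 8 3 6 (Copy true 36 16 3 6 (Copy true 35 8 3 6
  (Uncopy true 36 16 11 14 (Square 6 [:: 3; 4; 7; 6; 5; 2; 0; 1]))))) (Copy
  false 0 8 6 3 (Copy true 36 16 6 3 (Copy true 35 8 6 3 (Uncopy true 36 16 14
  11 (Square 6 [:: 3; 7; 4; 6; 5; 2; 0; 1])))))))))))))) (Copy false 0 8 1 4
  (Compare 0 4 (Copy false 0 8 1 5 (Compare 5 1 (Copy false 0 8 6 2 (Square 0
  [:: 5; 1; 2; 0; 4; 3; 6; 7])) (Copy false 0 8 2 6 (Compare 2 5 (Copy false 0
  8 3 6 (Square 0 [:: 1; 2; 5; 0; 4; 3; 6; 7])) (Copy false 0 8 6 3 (Square 0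
  [:: 1; 5; 2; 0; 4; 3; 6; 7])))))) (Copy false 0 8 5 1 (Compare 5 1 (Copy
  false 0 8 6 2 (Square 0 [:: 5; 1; 2; 4; 0; 3; 6; 7])) (Copy false 0 8 2 6
  (Compare 2 5 (Copy false 0 8 3 6 (Square 0 [:: 1; 2; 5; 4; 0; 3; 6; 7]))
  (Copy false 0 8 6 3 (Square 0 [:: 1; 5; 2; 4; 0; 3; 6;
  7])))))))))))))))))))) (Uncopy false 0 12 9 11 (Cycle 8 10)) (Compare 4 2
  (Copy false 0 16 5 3 (Copy true 36 16 13 11 (Chain [:: 37; 36; 34] (Chain
  [:: 36; 34; 72] (Above 36 34 (Uncopy true 36 16 15 11 (Cover true 34 (Uncopy
  true 34 4 1 3 (Cycle 32 34)) (Copy true 34 8 4 7 (Cycle 35 72)) (Uncopy true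
  34 12 0 3 (Cycle 15 18)) (Uncopy true 34 16 11 15 (Cycle 18 22)))))))))
  (Copy false 0 16 3 5 (Copy true 36 16 11 13 (Uncopy true 35 8 3 5 (Uncopy
  true 36 16 3 5 (Compare 6 8 (Square 1 [:: 0; 1; 3; 2]) (Compare 14 16
  (Square 9 [:: 0; 1; 3; 2]) (Compare 0 5 (Above 0 5 (Copy false 0 16 0 6
  (Copy true 36 16 8 14 (Uncopy true 35 8 0 6 (Uncopy true 36 16 0 6 (Square 6
  [:: 3; 4; 2; 0; 1; 7; 6; 5])))))) (Copy false 0 16 6 1 (Copy true 36 16 14 9
  (Uncopy true 35 8 6 1 (Uncopy true 36 16 6 1 (Compare 3 0 (Copy false 0 16 4
  1 (Copy true 36 16 12 9 (Uncopy true 35 8 4 1 (Uncopy true 36 16 4 1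
  (Compare 13 9 (Copy true 36 16 6 2 (Copy true 35 8 6 2 (Uncopy true 36 16 14
  10 (Square 6 [:: 7; 3; 4; 6; 5; 2; 0; 1])))) (Copy true 36 16 2 6 (Copy true
  35 8 2 6 (Uncopy true 36 16 10 14 (Compare 10 13 (Copy true 36 16 3 6 (Copy
  true 35 8 3 6 (Uncopy true 36 16 11 14 (Square 6 [:: 3; 4; 7; 6; 5; 2; 0;
  1])))) (Copy true 36 16 6 3 (Copy true 35 8 6 3 (Uncopy true 36 16 14 11
  (Square 6 [:: 3; 7; 4; 6; 5; 2; 0; 1]))))))))))))) (Above 0 3 (Copy false 0
  16 0 4 (Copy true 36 16 8 12 (Uncopy true 35 8 0 4 (Uncopy true 36 16 0 4
  (Compare 0 4 (Above 0 4 (Copy false 0 16 0 5 (Copy true 36 16 8 13 (Uncopy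
  true 35 8 0 5 (Uncopy true 36 16 0 5 (Compare 13 9 (Copy true 36 16 6 2
  (Copy true 35 8 6 2 (Uncopy true 36 16 14 10 (Square 6 [:: 7; 3; 4; 2; 0; 1;
  6; 5])))) (Copy true 36 16 2 6 (Copy true 35 8 2 6 (Uncopy true 36 16 10 14
  (Compare 10 13 (Copy true 36 16 3 6 (Copy true 35 8 3 6 (Uncopy true 36 16
  11 14 (Square 6 [:: 3; 4; 7; 2; 0; 1; 6; 5])))) (Copy true 36 16 6 3 (Copy
  true 35 8 6 3 (Uncopy true 36 16 14 11 (Square 6 [:: 3; 7; 4; 2; 0; 1; 6;
  5])))))))))))))) (Copy false 0 16 5 1 (Copy true 36 16 13 9 (Uncopy true 35
  8 5 1 (Uncopy true 36 16 5 1 (Compare 13 9 (Copy true 36 16 6 2 (Copy true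
  35 8 6 2 (Uncopy true 36 16 14 10 (Square 6 [:: 7; 3; 4; 6; 2; 0; 1; 5]))))
  (Copy true 36 16 2 6 (Copy true 35 8 2 6 (Uncopy true 36 16 10 14 (Compare
  10 13 (Copy true 36 16 3 6 (Copy true 35 8 3 6 (Uncopy true 36 16 11 14
  (Square 6 [:: 3; 4; 7; 6; 2; 0; 1; 5])))) (Copy true 36 16 6 3 (Copy true 35
  8 6 3 (Uncopy true 36 16 14 11 (Square 6 [:: 3; 7; 4; 6; 2; 0; 1;
  5]))))))))))))))))))))))))))))))))))))) (Copy true 35 12 5 7 (Cycle 32 34))
  (Uncopy true 35 16 12 15 (Cycle 19 22)))))))))) (Uncopy true 37 8 7 4
  (Uncopy true 37 8 7 5 (Cover true 36 (Uncopy true 36 4 1 3 (Uncopy true 36 4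
  3 0 (Uncopy true 37 8 3 0 (Cover true 35 (Uncopy true 35 4 0 3 (Cycle 31
  34)) (Uncopy true 35 8 4 7 (Cycle 27 30)) (Uncopy true 35 12 8 11 (Cycle 23
  26)) (Uncopy true 35 16 9 11 (Uncopy true 35 16 12 15 (Chain [:: 20; 19; 22]
  (Square 16 [:: 1; 0; 2; 3])))))))) (Uncopy true 36 8 5 7 (Cycle 28 30))
  (Uncopy true 36 12 9 11 (Uncopy true 36 12 11 8 (Copy true 37 8 1 3 (Copy
  true 37 8 3 0 (Uncopy true 36 12 5 7 (Uncopy true 36 12 7 4 (Square 19 [::
  2; 1; 3; 0]))))))) (Uncopy true 36 16 13 15 (Uncopy true 36 16 15 12 (Cover
  true 35 (Uncopy true 35 4 0 3 (Uncopy true 36 16 8 11 (Chain [:: 16; 15; 18]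
  (Square 16 [:: 1; 0; 2; 3])))) (Uncopy true 35 8 4 7 (Cycle 27 30)) (Uncopy
  true 35 12 3 1 (Copy true 35 12 5 7 (Copy true 36 16 11 9 (Cycle 34 32))))
  (Uncopy true 35 16 12 15 (Cycle 19 22)))))))) (Uncopy true 37 12 11 8
  (Uncopy true 37 12 11 9 (Cover true 36 (Uncopy true 36 4 1 3 (Uncopy true 36
  4 3 0 (Uncopy true 37 12 7 4 (Cover true 35 (Uncopy true 35 4 0 3 (Cycle 31
  34)) (Uncopy true 35 8 1 3 (Cycle 24 26)) (Uncopy true 35 12 8 11 (Cycle 23
  26)) (Uncopy true 35 16 12 15 (Cycle 19 22)))))) (Copy true 36 8 3 1 (Uncopy
  true 37 12 7 5 (Square 19 [:: 2; 3; 1; 0]))) (Uncopy true 36 12 9 11 (Cycle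
  24 26)) (Uncopy true 36 16 13 15 (Uncopy true 36 16 15 12 (Copy true 37 12 5
  7 (Copy true 37 12 7 4 (Uncopy true 36 16 9 11 (Uncopy true 36 16 11 8 (Copy
  true 37 12 1 3 (Copy true 37 12 3 0 (Uncopy true 36 16 5 7 (Uncopy true 36
  16 7 4 (Square 11 [:: 2; 1; 3; 0])))))))))))))) (Uncopy true 37 16 15 12
  (Uncopy true 37 16 15 13 (Cover true 36 (Uncopy true 36 4 1 3 (Uncopy true
  36 4 3 0 (Cover true 35 (Uncopy true 35 4 0 3 (Cycle 31 34)) (Uncopy true 35
  8 1 3 (Uncopy true 35 8 4 7 (Uncopy true 37 16 1 3 (Uncopy true 37 16 4 7
  (Chain [:: 12; 11; 14] (Square 8 [:: 1; 0; 2; 3])))))) (Uncopy true 35 12 5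
  7 (Cycle 20 22)) (Uncopy true 35 16 12 15 (Cycle 19 22))))) (Uncopy true 36
  8 5 7 (Uncopy true 36 8 7 4 (Uncopy true 37 16 5 7 (Cover true 35 (Uncopy
  true 35 4 0 3 (Uncopy true 36 8 0 3 (Uncopy true 37 16 0 3 (Chain [:: 8; 7;
  10] (Square 8 [:: 1; 0; 2; 3]))))) (Uncopy true 35 8 4 7 (Cycle 27 30))
  (Uncopy true 35 12 1 3 (Copy true 35 12 7 5 (Copy true 37 16 9 11 (Cycle 32
  34)))) (Uncopy true 35 16 12 15 (Cycle 19 22)))))) (Copy true 36 12 7 5
  (Uncopy true 37 16 11 9 (Copy true 36 12 3 1 (Uncopy true 37 16 7 5 (Square
  11 [:: 2; 3; 1; 0]))))) (Uncopy true 36 16 13 15 (Cycle 20 22)))))))))).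

Lemma suffix_refuted (n q : nat) (f : nat -> nat) (r : refutation) :
  3 <= q <= n -> n <= 38 ->
  (forall l, l \in [:: 4; 8; 12; 16] -> l.*2 <= n.+1 -> l.*2 <= q.+1) ->
  bicrucial_word n f -> f n.-1 < f n.-2 < f (n - 3) ->
  ~~ refutes q false (step_facts q false) [::] r.
Proof.
move=> qn n38 short [fw nosq satr _] /andP[down1 down2].
pose g j := f (n - q + j).
have [_ finj] := fw.
have ginj i j : i < q -> j < q -> g i = g j -> i = j by move=> iq jq /finj; lia.
have g_nosq : ~ has_square q g.
  case=> k [l [l2 kl iso]]; apply: nosq; exists (n - q + k), l.
  split=> //; first by lia.
  by move=> i j il jl; have := iso i j il jl; rewrite /g !addnA.
apply: (@refutesP q g false) => //.
  apply: covered_suffix => //; first by lia.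
  by apply: saturated_covered => //; lia.
move=> a b ab; apply: step_factsP => //; rewrite /g; first by lia.
  by move: down2; congr (f _ < f _); lia.
by move: ab; rewrite (_ : (_ < _) = false) //; apply/negbTE; rewrite -leqNgt ltnW //;
  move: down1; congr (f _ < f _); lia.
Qed.

(** By [f 1 < f 2] the last step but one of the flipped word goes down, so the left end is covered
    too. *)
Lemma word_refuted (n : nat) (f : nat -> nat) (r : refutation) :
  3 <= n <= 38 -> bicrucial_word n f ->
  f n.-2 < f (n - 3) -> f 1 < f 2 ->
  ~~ refutes n true (step_facts n (f n.-2 < f n.-1)) [::] r.
Proof.
move=> n_bounds [fw nosq satr satl] down up; have [_ finj] := fw.
apply: (@refutesP n f) => //.
- exact: saturated_covered.
- move=> _; apply: covered_flip; apply: saturated_covered => //.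
  + exact: is_word_flip.
  + by move/has_square_flip.
  by move: up; rewrite /flip; congr (f _ < f _); lia.
by move=> a b; apply: step_factsP => //; lia.
Qed.

Lemma compl_wlog (n : nat) (P : (nat -> nat) -> Prop) (x y : nat) :
  x < n -> y < n -> x != y ->
  (forall f, bicrucial_word n f -> f x < f y -> ~ P f) ->
  (forall f, bicrucial_word n f -> P f -> P (compl n f)) ->
  forall f, bicrucial_word n f -> ~ P f.
Proof.
move=> xn yn xy noP Pcompl f fb Pf; have [fw _ _ _] := fb; have [_ finj] := fw.
case: (ltngtP (f x) (f y)) => [lt_xy|lt_yx|/(finj _ _ xn yn)/eqP].
- exact: noP Pf.
- by apply: (noP _ (bicrucial_compl fb)) (Pcompl _ fb Pf); rewrite compl_lt.
by rewrite (negbTE xy).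
Qed.

(** From length 3 on, up to complement, a new letter just above the last one completes a square of
    half-length at least 4, which takes 8 letters. *)
Lemma bicrucial_gt6 (n : nat) (f : nat -> nat) : 0 < n -> bicrucial_word n f -> 6 < n.
Proof.
move=> n0 fb; rewrite ltnNge; apply/negP => n6.
case: (leqP 3 n) => [n3|n3]; last first.
  have [fw nosq sat _] := fb.
  by have [l [l2 ln _]] := extend_square n0 fw nosq sat; lia.
apply: (@compl_wlog n (fun=> True) n.-2 (n - 3) _ _ _ _ _ f fb) => //; try lia.
move=> {fb}f [fw nosq sat _] down _.
have [|||l [+ ln _]] := saturated_covered _ fw nosq sat down (i := n.-1).
- by lia.
- by lia.
- by left.
by rewrite !inE; lia.
Qed.

Definition plateau (n : nat) (f : nat -> nat) : bool :=
  (f n.-1 < f n.-2) == (f n.-2 < f (n - 3)).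

Lemma plateau_compl (n : nat) (f : nat -> nat) : 3 <= n -> is_word n f ->
  plateau n f -> plateau n (compl n f).
Proof.
move=> n3 fw; rewrite /plateau !compl_lt //; try lia; have [_ finj] := fw.
have ne1 : f n.-1 <> f n.-2 by move/finj; lia.
have ne2 : f n.-2 <> f (n - 3) by move/finj; lia.
by lia.
Qed.

Lemma bicrucial_no_plateau (n : nat) (f : nat -> nat) :
  6 < n -> n <= 30 \/ n = 38 -> bicrucial_word n f -> ~ plateau n f.
Proof.
move=> n6 n_ok; move: f.
apply: (@compl_wlog n (fun f => plateau n f) n.-2 (n - 3)); try lia; last first.
  by move=> f [fw _ _ _]; apply: plateau_compl => //; lia.
move=> f fb down; rewrite /plateau down => /eqP down'.
have downs : f n.-1 < f n.-2 < f (n - 3) by rewrite down' down.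
case: n_ok => [n30|n38].
  (* The suffix length [q.*2.+1] is 7, 15 or 23; the bound on [n] excludes the next multiple of
     4. *)
  have short q : q.*2.+1 <= n -> (n < (q + 4).*2.+1) && [|| q == 3, q == 7 | q == 11] ->
      forall l, l \in [:: 4; 8; 12; 16] -> l.*2 <= n.+1 -> l.*2 <= q.*2.+2.
    by move=> qn nq l; rewrite !inE; lia.
  case: (leqP 23 n) => n23.
    have := @suffix_refuted n 23 f suffix23_refutation ltac:(lia) ltac:(lia)
      (short 11 ltac:(lia) ltac:(lia)) fb downs.
    by rewrite (_ : refutes _ _ _ _ _ = true) //; vm_compute.
  case: (leqP 15 n) => n15.
    have := @suffix_refuted n 15 f suffix15_refutation ltac:(lia) ltac:(lia)
      (short 7 ltac:(lia) ltac:(lia)) fb downs.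
    by rewrite (_ : refutes _ _ _ _ _ = true) //; vm_compute.
  have := @suffix_refuted n 7 f suffix7_refutation ltac:(lia) ltac:(lia)
    (short 3 ltac:(lia) ltac:(lia)) fb downs.
  by rewrite (_ : refutes _ _ _ _ _ = true) //; vm_compute.
subst n; have [fw nosq _ _] := fb; have [_ finj] := fw.
have first_up : f 1 < f 2.
  by have /= -> := @step_from_end 38 f 35 finj nosq isT; rewrite ltnNge ltnW.
have := @word_refuted 38 f word38_refutation isT fb down.
rewrite (_ : (f 36 < f 37) = false); last by apply/negbTE; rewrite -leqNgt ltnW.
have -> : refutes 38 true (step_facts 38 false) [::] word38_refutation by vm_compute.
by move=> /(_ first_up).
Qed.

Lemma bicrucial_odd_short (n : nat) (f : nat -> nat) :
  n = 7 \/ n = 11 -> ~ bicrucial_word n f.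
Proof.
move=> n_ok fb; have n6 : 6 < n by lia.
have := bicrucial_no_plateau n6 _ fb; apply; first by lia.
apply/negPn/negP; move: f fb.
apply: (@compl_wlog n (fun f => ~~ plateau n f) n.-2 (n - 3)); try lia.
  move=> f fb down; rewrite /plateau down => not_down.
  have [fw nosq _ _] := fb; have [_ finj] := fw.
  have up : f n.-2 < f n.-1.
    by have ne : f n.-2 <> f n.-1 by [move/finj; lia]; lia.
  have not_up : (f (n - 3) < f n.-2) = false by lia.
  case: n_ok => n_eq; subst n.
    (* As 4 divides [n - 3], the step from 1 to 2 has the direction of the last step. *)
    have first_up : f 1 < f 2 by have /= -> := @step_from_end 7 f 4 finj nosq isT; rewrite up.
    have := @word_refuted 7 f word7_refutation isT fb down.
    rewrite up; have -> : refutes 7 true (step_facts 7 true) [::] word7_refutation.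
      by vm_compute.
    by move=> /(_ first_up).
  have first_up : f 1 < f 2 by have /= -> := @step_from_end 11 f 8 finj nosq isT; rewrite up.
  have := @word_refuted 11 f word11_refutation isT fb down.
  rewrite up; have -> : refutes 11 true (step_facts 11 true) [::] word11_refutation.
    by vm_compute.
  by move=> /(_ first_up).
move=> f fb /negP no_plat; apply/negP => plat; have [fw _ _ _] := fb.
have [_ finj] := fw; apply: no_plat; move: plat; rewrite /plateau !compl_lt //; try lia.
have ne1 : f n.-1 <> f n.-2 by move/finj; lia.
have ne2 : f n.-2 <> f (n - 3) by move/finj; lia.
by lia.
Qed.

Lemma bicrucial_length (n : nat) (f : nat -> nat) : 0 < n -> bicrucial_word n f ->
  n = 9 \/ (odd n /\ 13 <= n) \/ (~~ odd n /\ 32 <= n /\ n <> 38).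
Proof.
move=> n0 fb; have n6 := bicrucial_gt6 n0 fb.
have [fw nosq _ _] := fb; have [_ finj] := fw.
case: (boolP (odd n)) => n_odd.
  have no7 : n <> 7 by move=> n7; apply: (@bicrucial_odd_short n f); [left|].
  have no11 : n <> 11 by move=> n11; apply: (@bicrucial_odd_short n f); [right|].
  by lia.
case: (boolP ((n <= 30) || (n == 38))) => [/orP n_short|]; last by lia.
have {}n_short : n <= 30 \/ n = 38 by case: n_short => [|/eqP]; [left|right].
have odd0 : odd n.-2 = false by lia.
have odd1 : odd (n - 3) = true by lia.
have half01 : odd n.-2./2 = ~~ odd (n - 3)./2 by lia.
have eq0 : n - n.-1.+1 = 0 by lia.
have eq01 : n - n.-2.+2 = 0 /\ n - n.-2.+1 = 1 by lia.
have eq12 : n - (n - 3).+2 = 1 /\ n - (n - 3).+1 = 2 by lia.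
have flip_lt x y : x < n -> y < n -> x != y -> (f x < f y) = ~~ (f y < f x).
  by move=> xn yn xy; case: ltngtP => // /(finj _ _ xn yn)/eqP; rewrite (negbTE xy).
have last2 : (f n.-1 < f n.-2) = ~~ (f n.-2 < f n.-1) by apply: flip_lt; lia.
have last3 : (f n.-2 < f (n - 3)) = ~~ (f (n - 3) < f n.-2) by apply: flip_lt; lia.
have [in0 in1] : n.-2 + 2 <= n /\ n - 3 + 2 <= n by lia.
have step0 := step_from_end finj nosq in0.
have step1 := step_from_end finj nosq in1.
rewrite (proj1 eq01) (proj2 eq01) odd0 half01 in step0.
rewrite (proj1 eq12) (proj2 eq12) odd1 in step1.
(* By [half01] exactly one of the first two steps is reversed relative to its counterpart among the
   last two, so exactly one end is a plateau. *)
have plat : plateau n f || plateau n (flip n f).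
  rewrite /plateau /flip eq0 (proj2 eq01) (proj2 eq12) step0 step1 last2 last3.
  by case: (f n.-2 < f n.-1); case: (f (n - 3) < f n.-2); case: (odd (n - 3)./2).
case/orP: plat => plat; first by case: (bicrucial_no_plateau n6 n_short fb).
by case: (bicrucial_no_plateau n6 n_short (bicrucial_flip fb)).
Qed.

Theorem theorem3 (n : nat) (n_gt0 : 0 < n) :
  (exists s : {perm 'I_n}, bicrucial s) <->
  (n = 9 \/ (odd n /\ 13 <= n) \/ (~~ odd n /\ 32 <= n /\ n <> 38)).
Proof.
rewrite bicrucialP; split=> [[f]|]; first exact: bicrucial_length.
exact: bicrucial_word_exists.
Qed.
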